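(* Let $H$ be a $3$-uniform hypergraph on $n$ vertices that contains no linear cycle and does not contain the complete $3$-uniform hypergraph $K_5^3$ on five vertices as a subhypergraph. Then $\alpha(H)\ge\lceil n/2\rceil$. Moreover this bound is sharp: for every $n\ge 3$ there is a $3$-uniform hypergraph $H_n$ on $n$ vertices that contains no linear cycle, does not contain $K_5^3$ as a subhypergraph, and satisfies $\alpha(H_n)=\lceil n/2\rceil$.
   Context: A $3$-uniform hypergraph $H=(V,E)$ consists of a (finite) vertex set $V$ and a set $E$ of hyperedges, each hyperedge being a $3$-element subset of $V$. A linear cycle of length $k\ge 3$ is an alternating sequence $v_1,h_1,v_2,h_2,\ldots,v_k,h_k$ of distinct vertices and distinct hyperedges such that $h_i\cap h_{i+1}=\{v_{i+1}\}$ for each $i\in\{1,\ldots,k-1\}$, $h_1\cap h_k=\{v_1\}$, and $h_i\cap h_j=\emptyset$ whenever $1<|j-i|<k-1$. $K_5^3$ is the hypergraph on $5$ vertices whose hyperedges are all $3$-element subsets of the vertex set. An independent set of $H$ is a set $I\subseteq V$ such that no $e\in E$ satisfies $e\subseteq I$; $\alpha(H)$ is the size of a largest independent set of $H$. *)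

(* Defs.v *)
From mathcomp Require Import all_boot all_order all_algebra.

Set Implicit Arguments.
Unset Strict Implicit.
Unset Printing Implicit Defensive.

(* The vertex set is the whole finite type V, so a hypergraph has #|V|
   vertices; isolated vertices are allowed. *)
Record hypergraph3 (V : finType) := Hypergraph3 {
  edges : {set {set V}};
  edges_card3 : forall e : {set V}, e \in edges -> #|e| = 3
}.

(* Indices run over 0, ..., k-1 instead of 1, ..., k, so that h i and h i.+1
   meet in v i.+1, and the first and last hyperedges meet in v 0.
   `|i - j| is the distance between i and j, not a truncated difference. *)
Definition is_linear_cycle (V : finType) (H : hypergraph3 V) (k : nat)
    (v : 'I_k -> V) (h : 'I_k -> {set V}) : Prop :=
  [/\ injective v /\ injective h,
      forall i : 'I_k, h i \in edges H,
      forall i j : 'I_k, j = i.+1 :> nat -> h i :&: h j = [set v j],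
      forall i j : 'I_k, i = 0 :> nat -> j = k.-1 :> nat ->
        h i :&: h j = [set v i]
    & forall i j : 'I_k, 1 < `|i - j|%N < k.-1 -> h i :&: h j = set0].

Definition has_linear_cycle (V : finType) (H : hypergraph3 V) : Prop :=
  exists (k : nat) (v : 'I_k -> V) (h : 'I_k -> {set V}),
    3 <= k /\ is_linear_cycle H v h.

Definition complete_edges (m : nat) : {set {set 'I_m}} :=
  [set e : {set 'I_m} | #|e| == 3].

Lemma complete_edges_card3 (m : nat) (e : {set 'I_m}) :
  e \in complete_edges m -> #|e| = 3.
Proof. by rewrite inE => /eqP. Qed.

Definition complete3 (m : nat) : hypergraph3 'I_m :=
  Hypergraph3 (@complete_edges_card3 m).

(* H contains a (not necessarily induced) copy of F. *)
Definition contains_subhypergraph (U V : finType)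
    (F : hypergraph3 U) (H : hypergraph3 V) : Prop :=
  exists f : U -> V,
    injective f /\ forall e : {set U}, e \in edges F -> f @: e \in edges H.

Definition independent (V : finType) (H : hypergraph3 V) (I : {set V}) : bool :=
  [forall e in edges H, ~~ (e \subset I)].

Definition alpha (V : finType) (H : hypergraph3 V) : nat :=
  \max_(I : {set V} | independent H I) #|I|.

(* Main.v *)
Require Import Defs.
From mathcomp Require Import all_boot all_order all_algebra.
From mathcomp Require Import zify.
From Stdlib Require Import Classical.

(** Why the bound holds. Call an edge [f] private to a vertex [x] of an edge [e]
    when [f] meets [e] exactly in [x]. If some edge [e] has a vertex [x] with no
    private edge, then a two-colouring of the other edges can be repaired to a
    two-colouring of all of them: when [e] is monochromatic, flip [x]; an edge
    spoiled by the flip would be private to [x]. Hence, by induction on the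
    number of edges, a family without linear cycles is two-colourable as soon as
    every nonempty family in which all private edges exist contains a complete
    hypergraph on five vertices ([private_edges_complete_five]); one of the two
    colour classes is then an independent set of at least half the vertices
    ([two_colourable], [alpha_lower_bound]).

    Assume that all private edges exist, and take a largest vertex set [U]
    spanned by a linear tree (a [tree_set]). At a leaf [y] of a spanning tree of
    [U], with leaf edge [ybc], the private edge [yuv] stays inside [U], for
    otherwise it would extend the tree or close a linear cycle. This closure
    property of [U], required for all spanning trees and all leaves but one
    exempt root [r], is [leaf_closing], and [leaf_closing_complete_five] shows
    by induction on the size of [U] that it produces the five vertices.

    The engine is [forced_split]. In the absence of linear cycles, the two
    vertices [u] and [v] of an edge [yuv] closing at [y] must be the two
    vertices of one tree edge [wuv] that lie away from [y], since otherwise the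
    tree contains a path from [y] to one of them that avoids the other. So [wuv]
    can be exchanged for [yuv], which moves the two branches hanging at [u] and
    [v] from [w] to [y]. Most steps below fix a part [A] of [U] that hangs at a
    cut vertex [a] and is extremal in size. Either [A] is leaf-closing with root
    [a], and the induction applies to it, or some closing edge leaves [A]
    ([escaping_edge]), and then a linear cycle or an exchange of branches
    contradicts the extremal choice.

    In this way the root becomes a leaf ([root_is_leaf]), and it lies on two
    edges [rqw] and [rqx] whose ends [w] and [x] lie in one branch at [rqw]
    ([pseudo_cycle_exists]): a path from [w] to [x] with both ends joined to the
    same pair [rq], which closes up without being a linear cycle. Its second
    pivot [q] is a leaf as well ([hub_single]). The private edge of [q] is
    [qst], and all vertices joined to the pair [rq] other than [w] are among [s]
    and [t] ([hub_split]); the branches at [s] and [t] are trivial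
    ([diamond_single]), and [w], [s], [t] play symmetric roles ([hub_five]). So
    [U] consists of [r], [q], [w], [s], [t], and the remaining edges are private
    edges of spanning trees with two edges ([complete_five]).

    Why it is sharp. Group 0, 1, 2, ... into consecutive pairs and take as edges
    all triples made of a pair and a smaller number, together with all triples
    below 4 ([tower]). In a linear cycle, an edge with largest top could meet
    its two neighbours only in its smallest vertex; and an independent set that
    contains a pair contains nothing below it ([tower_independent]). *)

Set Implicit Arguments.
Unset Strict Implicit.
Unset Printing Implicit Defensive.

(** * Finite sets *)

Definition apart (T : finType) (A B : {set T}) := forall z, z \in A -> z \in B -> False.
Definition meets_at (T : finType) (A B : {set T}) c := forall z, z \in A -> z \in B -> z = c.

Lemma apartUl (T : finType) (A B C : {set T}) : apart (A :|: B) C -> apart A C /\ apart B C.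
Proof. by move=> d; split=> z h; apply: d; rewrite inE h ?orbT. Qed.
Lemma apartUr (T : finType) (A B C : {set T}) : apart C (A :|: B) -> apart C A /\ apart C B.
Proof. by move=> d; split=> z h h'; apply: (d z h); rewrite inE h' ?orbT. Qed.
Lemma apart1l (T : finType) (x : T) (C : {set T}) : apart [set x] C -> x \notin C.
Proof. by move=> d; apply/negP=> h; apply: (d x); rewrite ?inE. Qed.
Lemma apart1r (T : finType) (x : T) (C : {set T}) : apart C [set x] -> x \notin C.
Proof. by move=> d; apply/negP=> h; apply: (d x); rewrite ?inE. Qed.
Lemma meets_atUl (T : finType) (A B C : {set T}) x : meets_at (A :|: B) C x -> meets_at A C x /\ meets_at B C x.
Proof. by move=> d; split=> z h; apply: d; rewrite inE h ?orbT. Qed.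
Lemma meets_atUr (T : finType) (A B C : {set T}) x : meets_at C (A :|: B) x -> meets_at C A x /\ meets_at C B x.
Proof. by move=> d; split=> z h h'; apply: (d z h); rewrite inE h' ?orbT. Qed.

Ltac split_hyp := match goal with
 | H : apart (_ :|: _) _ |- _ => let H' := fresh in have [H' ?] := apartUl H; clear H
 | H : apart _ (_ :|: _) |- _ => let H' := fresh in have [H' ?] := apartUr H; clear H
 | H : apart [set _] _ |- _ => let H' := fresh in have H' := apart1l H; clear H
 | H : apart _ [set _] |- _ => let H' := fresh in have H' := apart1r H; clear H
 | H : meets_at (_ :|: _) _ _ |- _ => let H' := fresh in have [H' ?] := meets_atUl H; clear H
 | H : meets_at _ (_ :|: _) _ |- _ => let H' := fresh in have [H' ?] := meets_atUr H; clear H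
 | H : is_true (?x \notin pred_of_set (_ :|: _)) |- _ => move: H; rewrite (in_setU x) negb_or; case/andP=> ? ?
 | H : is_true (?x \notin pred_of_set [set _]) |- _ => move: H; rewrite (in_set1 x) => /eqP ?
 | H : _ /\ _ |- _ => case: H => ? ?
 end.
(** Marks an inclusion as already applied to a vertex; without this record the
    forward chaining of [set_tac] would apply it again after each case split
    and not terminate. *)
Definition seen (T : finType) (A B : pred_sort (predPredType T)) (z : T) := True.

Ltac forward := match goal with
 | H : ?a <> ?a |- _ => by case: H
 | H : is_true (?z \in ?A), N : is_true (?z \notin ?A) |- _ => by case: (negP N H)
 | H : apart ?A ?B, H1 : is_true (?z \in pred_of_set ?A), H2 : is_true (?z \in pred_of_set ?B) |- _ => by case: (H z H1 H2)
 | H : is_true (_ \in pred_of_set [set _]) |- _ => move/set1P: H => H; try subst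
 | H : meets_at ?A ?B ?c, H1 : is_true (?z \in pred_of_set ?A), H2 : is_true (?z \in pred_of_set ?B) |- _ =>
    lazymatch z with c => fail | _ => have ? := H z H1 H2; clear H1; try subst end
 | H : {subset ?A <= ?B}, H1 : is_true (?z \in ?A) |- _ =>
    lazymatch goal with
    | _ : seen A B z |- _ => fail
    | _ => have ? : seen A B z := I; have ? := H z H1
    end
 | H : is_true (_ \in pred_of_set (_ :|: _)) |- _ => case/setUP: H => H
 end.
Ltac intro_goal := match goal with
 | |- apart _ _ => let z := fresh "z" in let h1 := fresh "h" in let h2 := fresh "h" in move=> z h1 h2
 | |- meets_at _ _ _ => let z := fresh "z" in let h1 := fresh "h" in let h2 := fresh "h" in move=> z h1 h2
 | |- {subset _ <= _} => let z := fresh "z" in let h1 := fresh "h" in move=> z h1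
 | |- _ <> _ => let h1 := fresh "h" in move=> h1; try subst
 | |- is_true (_ \notin _) => let h1 := fresh "h" in apply/negP=> h1
 end.
Ltac mem_tac := solve [ assumption | congruence | symmetry; assumption
  | rewrite !inE; repeat match goal with H : is_true (_ \in _) |- _ => rewrite H end; rewrite ?eqxx ?orbT //=].
(** Saturates the context with consequences of memberships, inclusions and
    disjointness, splitting unions last so that most branches are closed
    before they multiply. *)
Ltac set_tac := repeat split_hyp; repeat intro_goal; repeat forward; try mem_tac.
Ltac set_eq_tac := apply/setP=> ?; rewrite !inE; do ?case: (_ \in _) => //=; do ?case: (_ == _) => //=; rewrite ?orbT ?orbF ?andbT //.

Lemma ex_min_measure (T : Type) (P : T -> Prop) (f : T -> nat) :
  (exists x, P x) -> exists x, P x /\ forall y, P y -> f x <= f y.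
Proof.
move=> [x Px]; have [n] := ubnP (f x); elim: n x Px => // n IH x Px /ltnSE lx.
have [[y [Py ly]]|no] := classic (exists y, P y /\ f y < f x).
  by apply: (IH y Py); apply: leq_trans lx.
by exists x; split=> // y Py; rewrite leqNgt; apply/negP=> ly; apply: no; exists y.
Qed.

Lemma ex_max_card (T : finType) (P : {set T} -> Prop) :
  (exists A, P A) -> exists A, P A /\ forall B, P B -> #|B| <= #|A|.
Proof.
move=> /(@ex_min_measure _ P (fun A => #|T| - #|A|)) [A [PA mA]]; exists A; split=> // B /mA.
by rewrite leq_sub2lE // max_card.
Qed.

Lemma set_other (T : finType) (A : {set T}) a : a \in A -> A <> [set a] -> exists2 z, z \in A & z <> a.
Proof.
move=> aA nA; apply: NNPP => no; apply: nA; apply/setP=> z; rewrite inE.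
apply/idP/eqP => [zA|->] //; apply: NNPP => nz; apply: no; by exists z.
Qed.

Lemma set3_of_card (T : finType) (A : {set T}) : #|A| = 3 ->
  exists x y z : T, [/\ A = [set x; y; z], x <> y, x <> z & y <> z].
Proof.
move=> h; have /set0Pn [x xA] : A != set0 by rewrite -card_gt0 h.
have : #|A :\ x| == 2 by have := cardsD1 x A; rewrite xA h; lia.
move=> /cards2P [y [z [/eqP nyz eA]]]; exists x, y, z.
have yA : y \in A :\ x by rewrite eA; mem_tac.
have zA : z \in A :\ x by rewrite eA; mem_tac.
move: yA zA; rewrite !inE => /andP [/eqP n1 _] /andP [/eqP n2 _].
split=> //; try by move/esym.
by rewrite -(setD1K xA) eA setUA.
Qed.

(** * Linear paths and linear trees *)

Section TreeSets.
Variables (V : finType) (H : hypergraph3 V).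
Implicit Types (A B C D P Q S T U W X Y Z : {set V}) (a b c d p q r s t u v w x y z : V).

(** Edges are written by their three vertices, since almost every argument names
    all of them; [triple213] to [triple321] permute the names. *)
Definition triple a b c := [set a; b; c] \in edges H.

Lemma triple_distinct a b c : triple a b c -> [/\ a <> b, a <> c & b <> c].
Proof.
move=> /edges_card3; rewrite setUC cardsU1 cards2 !inE negb_or.
case: (eqVneq a b) => [->|/eqP nab]; first by case: (_ && _).
case: (eqVneq c a) => [->|/eqP nca] //=; case: (eqVneq c b) => [->|/eqP ncb] //= _.
by split=> // ?; subst.
Qed.
Lemma triple213 a b c : triple a b c -> triple b a c.
Proof. by rewrite /triple (setUC [set a]). Qed.
Lemma triple132 a b c : triple a b c -> triple a c b.
Proof. by rewrite /triple -!setUA (setUC [set b]). Qed.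
Lemma triple231 a b c : triple a b c -> triple b c a.
Proof. by move/triple213/triple132. Qed.
Lemma triple312 a b c : triple a b c -> triple c a b.
Proof. by move/triple132/triple213. Qed.
Lemma triple321 a b c : triple a b c -> triple c b a.
Proof. by move/triple231/triple213. Qed.

(** Only the vertex set of a linear path and its two ends are kept: whether a
    further path or edge can be attached depends on nothing else. One-vertex
    paths are included so that concatenation needs no case distinction. *)
Inductive linear_path : {set V} -> V -> V -> Prop :=
| path0 a : linear_path [set a] a a
| path_edge a b c : triple a b c -> linear_path [set a; b; c] a b
| path_cat X Y a b c : linear_path X a b -> linear_path Y b c -> meets_at X Y b -> linear_path (X :|: Y) a c.

Lemma path_ends X a b : linear_path X a b -> a \in X /\ b \in X.
Proof. by elim=> {X a b} [a|a b c _|X Y a b c _ [h1 h2] _ [h3 h4] _]; rewrite !inE ?h1 ?h4 ?eqxx ?orbT. Qed.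

(** Vertex sets spanned by a linear tree. The tree itself is forgotten, because
    exchanging edges changes the tree but not the set; [tree_set3] is the view
    of a tree from any one of its edges, whose removal leaves the branches
    [A], [B] and [C]. *)
Inductive tree_set : {set V} -> Prop :=
| tree_set1 v : tree_set [set v]
| tree_set3 A B C a b c : tree_set A -> tree_set B -> tree_set C -> apart A B -> apart A C -> apart B C ->
   a \in A -> b \in B -> c \in C -> triple a b c -> tree_set (A :|: B :|: C).

(** The same decomposition with the branches as data: [U] is spanned by a tree in
    which removal of the edge [abc] leaves branches attached at [a], [b] and
    [c]. *)
Record joined U A a B b C c : Prop := Joined {
  jtA : tree_set A; jtB : tree_set B; jtC : tree_set C;
  jAB : apart A B; jAC : apart A C; jBC : apart B C;
  jA : a \in A; jB : b \in B; jC : c \in C;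
  jE : triple a b c; jU : U = A :|: B :|: C }.

Lemma joined_tree_set U A a B b C c : joined U A a B b C c -> tree_set U.
Proof. by case=> *; subst; apply: (@tree_set3 A B C a b c). Qed.
Lemma joined213 U A a B b C c : joined U A a B b C c -> joined U B b A a C c.
Proof. by case=> *; split; set_tac; try exact: triple213; subst; set_eq_tac. Qed.
Lemma joined132 U A a B b C c : joined U A a B b C c -> joined U A a C c B b.
Proof. by case=> *; split; set_tac; try exact: triple132; subst; set_eq_tac. Qed.

Lemma joined_proper U A a B b C c : joined U A a B b C c -> #|A| < #|U|.
Proof.
case=> *; apply: proper_card; apply/properP; split; first by subst; rewrite -setUA subsetUl.
by exists b; set_tac; subst; mem_tac.
Qed.

Lemma joined_subs U A a B b C c : joined U A a B b C c ->
  [/\ {subset A <= U}, {subset B <= U} & {subset C <= U}].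
Proof. by case=> *; subst; split=> z h; rewrite !inE h ?orbT. Qed.

(** Two trees sharing one vertex form a tree: the branch of [B] that contains the
    shared vertex absorbs [A]. *)
Lemma tree_set_glue A B c : tree_set A -> tree_set B -> c \in A -> c \in B -> meets_at A B c -> tree_set (A :|: B).
Proof.
move=> tA tB; elim: tB => {B} [v|B1 B2 B3 b1 b2 b3 t1 I1 t2 I2 t3 I3 d12 d13 d23 h1 h2 h3 e] cA cB m.
  by move/set1P: cB => ?; subst; suff -> : A :|: [set v] = A by []; apply/setUidPl; rewrite sub1set.
repeat split_hyp.
case/setUP: cB => [/setUP [cB|cB]|cB].
- have -> : A :|: (B1 :|: B2 :|: B3) = (A :|: B1) :|: B2 :|: B3 by set_eq_tac.
  by apply: (tree_set3 (I1 cA cB _) t2 t3 _ _ d23 _ h2 h3 e); set_tac.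
- have -> : A :|: (B1 :|: B2 :|: B3) = B1 :|: (A :|: B2) :|: B3 by set_eq_tac.
  by apply: (tree_set3 t1 (I2 cA cB _) t3 _ d13 _ h1 _ h3 e); set_tac.
- have -> : A :|: (B1 :|: B2 :|: B3) = B1 :|: B2 :|: (A :|: B3) by set_eq_tac.
  by apply: (tree_set3 t1 t2 (I3 cA cB _) d12 _ _ h1 h2 _ e); set_tac.
Qed.

Lemma joined_glueA U A a B b C c D x : joined U A a B b C c -> tree_set D -> x \in A -> x \in D ->
  meets_at D U x -> joined (D :|: U) (D :|: A) a B b C c.
Proof.
case=> *; subst; repeat split_hyp; split=> //; set_tac; last by set_eq_tac.
by apply: (@tree_set_glue _ _ x); set_tac.
Qed.

(** The tree can be viewed from an edge through any prescribed vertex: in the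
    branch that contains [r], look for such an edge by induction and hang the
    other branches back at the vertex where they were attached. *)
Lemma root_split U r : tree_set U -> r \in U -> U = [set r] \/
  exists A B b C c, joined U A r B b C c.
Proof.
have [n] := ubnP #|U|; elim: n U r => // n IH U r /ltnSE ltn tU.
case: tU ltn => {U} [v|A0 B0 C0 a0 b0 c0 tA tB tC dAB dAC dBC hA hB hC e]; first by move=> _ /set1P ->; left.
have J : joined (A0 :|: B0 :|: C0) A0 a0 B0 b0 C0 c0 by [].
move: (A0 :|: B0 :|: C0) J => U J ltn rU; clear tA tB tC dAB dAC dBC hA hB hC e.
have : exists A a B b C c, joined U A a B b C c /\ r \in A.
  move: (rU); rewrite {1}(jU J) => /setUP [/setUP [h|h]|h].
  - by exists A0, a0, B0, b0, C0, c0.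
  - by exists B0, b0, A0, a0, C0, c0; split=> //; apply: joined213.
  - by exists C0, c0, A0, a0, B0, b0; split=> //; apply: joined213; apply: joined132.
move=> [A [a [B [b [C [c [{}J rA]]]]]]]; right.
have [eA|] := IH A r (leq_trans (joined_proper J) ltn) (jtA J) rA.
  case: (J) => *; subst; set_tac; by exists [set r], B, b, C, c.
move=> [A1 [B1 [b1 [C1 [c1 J1]]]]].
have tD : tree_set ([set a] :|: B :|: C) by case: J => *; apply: (@tree_set3 _ _ _ a b c); rewrite ?inE //; [constructor|set_tac|set_tac].
have eU : U = ([set a] :|: B :|: C) :|: A.
  rewrite (jU J); apply/setP=> z; rewrite !inE.
  by case: eqVneq => [->|_]; [rewrite (jA J) orbT | do !case: (_ \in _)].
have m : meets_at ([set a] :|: B :|: C) A a by case: J => *; set_tac.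
have aD : a \in [set a] :|: B :|: C by mem_tac.
rewrite eU.
move: (jA J); rewrite {1}(jU J1) => /setUP [/setUP [h|h]|h].
- by exists (([set a] :|: B :|: C) :|: A1), B1, b1, C1, c1; apply: (joined_glueA J1 tD h).
- exists A1, (([set a] :|: B :|: C) :|: B1), b1, C1, c1; apply: joined213.
  by apply: (joined_glueA (joined213 J1) tD h).
- exists A1, B1, b1, (([set a] :|: B :|: C) :|: C1), c1; apply: joined132; apply: joined213.
  by apply: (joined_glueA (joined213 (joined132 J1)) tD h).
Qed.

Lemma tree_set_path U a b : tree_set U -> a \in U -> b \in U -> exists X, {subset X <= U} /\ linear_path X a b.
Proof.
have [n] := ubnP #|U|; elim: n U a => // n IH U a /ltnSE ltn tU aU bU.
have [->|nab] := eqVneq a b; first by exists [set b]; split; [set_tac|constructor].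
case: (root_split tU aU) => [eU|[A [B [b1 [C [c J]]]]]].
  by move: bU nab; rewrite eU => /set1P ->; rewrite eqxx.
have IH' x D y D1 D2 e f : joined U D x D1 e D2 f -> y \in D -> b \in D -> exists X, {subset X <= D} /\ linear_path X y b.
  by move=> J'; apply: IH (leq_trans (joined_proper J') ltn) (jtA J').
have ex D d D' d' : joined U A a D d D' d' -> b \in D -> exists X, {subset X <= U} /\ linear_path X a b.
  move=> J' h; have [X [sX pX]] := IH' _ _ _ _ _ _ _ (joined213 J') (jB J') h.
  have [dX bX] := path_ends pX.
  exists ([set a; d; d'] :|: X); case: J' => *; split; first by subst; set_tac.
  by apply: path_cat pX _; [apply: path_edge| set_tac].
move: (bU); rewrite {1}(jU J) => /setUP [/setUP [h|h]|h].
- have [X [sX pX]] := IH' _ _ _ _ _ _ _ J (jA J) h.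
  by exists X; split=> //; rewrite (jU J); set_tac.
- exact: ex J h.
- exact: ex (joined132 J) h.
Qed.

Lemma path_edge_cons a b c X x : triple a b c -> linear_path X b x -> a \notin X -> c \notin X -> linear_path ([set a; b; c] :|: X) a x.
Proof. by move=> e pX nX nc'; apply: path_cat (path_edge e) pX _; set_tac. Qed.

Lemma joined_card U0 A a B b C c : joined U0 A a B b C c -> #|U0| = #|A| + #|B| + #|C|.
Proof.
case=> _ _ _ dAB dAC dBC _ _ _ _ ->; rewrite !cardsU.
have -> : A :&: B = set0 by apply/setP=> z; rewrite in_set0 in_setI; apply/negP=> /andP [*]; set_tac.
have -> : (A :|: B) :&: C = set0 by apply/setP=> z; rewrite in_set0 in_setI; apply/negP=> /andP [*]; set_tac.
by rewrite !cards0 !subn0.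
Qed.

Lemma tree_set_graft W0 W w S u T v D y : joined W0 W w S u T v -> tree_set D -> y \in D -> apart D W0 ->
  triple y u v -> tree_set (D :|: S :|: T).
Proof.
case=> *; subst; repeat split_hyp.
by apply: (@tree_set3 D S T y u v).
Qed.

(** An exchange of tree edges. Inside the branch [C] the edge [wuv] is replaced by
    [yuv], so that the branches at [u] and [v] hang at [y] in the branch [B],
    which becomes strictly larger. *)
Lemma joined_move U0 A a B b C c W w S u T v y : joined U0 A a B b C c -> joined C W w S u T v ->
  c \in W -> y \in B -> triple y u v -> joined U0 A a (B :|: S :|: T) b W c /\ #|B| < #|B :|: S :|: T|.
Proof.
move=> J J1 cW yB e; case: (J) => tA tB tC dAB dAC dBC aA bB _ eabc ->.
have sW : {subset W <= C} by rewrite (jU J1); set_tac.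
have sS : {subset S <= C} by rewrite (jU J1); set_tac.
have sT : {subset T <= C} by rewrite (jU J1); set_tac.
have tB' : tree_set (B :|: S :|: T) by apply: tree_set_graft J1 tB yB _ e.
rewrite (jU J1); case: J1 => tW _ _ dWS dWT dST _ uS _ _ _; split.
  by split=> //; set_tac; set_eq_tac.
apply: proper_card; apply/properP; split; first by rewrite -setUA subsetUl.
by exists u; set_tac.
Qed.

(** The situation in which an edge joining [s] and [t] to a vertex on the side of
    [b] can replace the tree edge [wst]. *)
Definition splits U b s t := exists W S T w, joined U W w S s T t /\ b \in W.
Definition avoiding_path U b s t := exists X, [/\ {subset X <= U}, linear_path X b s & t \notin X].

Lemma joined_glueAr U A a B b C c D x : joined U A a B b C c -> tree_set D -> x \in A -> x \in D ->
  meets_at D U x -> joined (U :|: D) (A :|: D) a B b C c.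
Proof. by move=> *; rewrite setUC (setUC A); apply: joined_glueA; eauto. Qed.

Lemma splits_glue U D d b s t : splits U d s t -> tree_set D -> d \in D -> b \in D -> meets_at D U d ->
  splits (U :|: D) b s t.
Proof.
move=> [W [S [T [w [J dW]]]]] tD dD bD m; exists (W :|: D), S, T, w; split; last by set_tac.
exact: joined_glueAr J tD dW dD m.
Qed.

(** In a fixed spanning tree, the paths from [b] to [s] and to [t] either allow
    one target to be reached without the other, or both enter their targets by
    the same edge. The proof looks at the tree from an edge [b d d'] through
    [b]. *)
Lemma split_or_path U b s t : tree_set U -> b \in U -> s \in U -> t \in U ->
  b <> s -> b <> t -> s <> t ->
  avoiding_path U b s t \/ avoiding_path U b t s \/ splits U b s t.
Proof.
have [n] := ubnP #|U|; elim: n U b s t => // n IH U b s t /ltnSE ltn tU bU sU tU' nbs nbt nst.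
case: (root_split tU bU) => [eU|[A [D [d [D' [d' J]]]]]].
  by move: sU; rewrite eU => /set1P ?; subst.
have inA s1 t1 : s1 \in A -> t1 \notin A -> avoiding_path U b s1 t1.
  move=> h1 h2; have [X [sX pX]] := tree_set_path (jtA J) (jA J) h1.
  by exists X; split=> //; [rewrite (jU J); set_tac | set_tac].
have inD D1 d1 D2 d2 s1 t1 : joined U A b D1 d1 D2 d2 -> s1 \in D1 -> t1 \notin D1 -> t1 <> d2 -> t1 <> b ->
   avoiding_path U b s1 t1.
  move=> J1 h1 h2 h3 h4; have [X [sX pX]] := tree_set_path (jtB J1) (jB J1) h1.
  exists ([set b; d1; d2] :|: X); split.
  - by case: (J1) => *; subst; set_tac.
  - by case: (J1) => *; apply: path_cat pX _; [exact: path_edge | set_tac].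
  - by case: (J1) => *; set_tac.
have mixed D1 d1 D2 d2 s1 t1 : joined U A b D1 d1 D2 d2 -> s1 \in D1 -> t1 \in D2 -> b <> s1 -> b <> t1 -> 
  avoiding_path U b s1 t1 \/ avoiding_path U b t1 s1 \/ splits U b s1 t1.
  move=> J1 h1 h2 n1 n2.
  have [e1|/eqP e1] := eqVneq t1 d2; last first.
    by left; apply: inD (J1) (h1) _ (e1) _; [case: (J1) => *; set_tac|congruence].
  have [e2|/eqP e2] := eqVneq s1 d1; last first.
    by right; left; apply: inD (joined132 J1) (h2) _ (e2) _; [case: (J1) => *; set_tac|congruence].
  by right; right; exists A, D1, D2, b; subst; split=> //; case: J1.
have both D1 d1 D2 d2 s1 t1 : joined U A b D1 d1 D2 d2 -> s1 \in D1 -> t1 \in D1 -> 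
   b <> s1 -> b <> t1 -> s1 <> t1 ->
  avoiding_path U b s1 t1 \/ avoiding_path U b t1 s1 \/ splits U b s1 t1.
  move=> J1 h1 h2 n1 n2 n3.
  have hit s2 t2 : s2 \in D1 -> t2 \in D1 -> d1 = s2 -> s2 <> t2 -> b <> t2 -> avoiding_path U b s2 t2.
    move=> k1 k2 k3 k4 k5; exists [set b; d1; d2]; split.
    - by case: (J1) => *; subst; set_tac.
    - by subst; apply: path_edge; case: J1.
    - by case: (J1) => *; set_tac.
  have [e1|/eqP e1] := eqVneq d1 s1; first by left; apply: hit.
  have [e2|/eqP e2] := eqVneq d1 t1; first by right; left; apply: hit => //; congruence.
  have ext s2 t2 : t2 \in D1 -> avoiding_path D1 d1 s2 t2 -> avoiding_path U b s2 t2.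
    move=> k [X [sX pX nX]]; exists ([set b; d1; d2] :|: X); split.
    - by case: (J1) => *; subst; set_tac.
    - by case: (J1) => *; apply: path_cat pX _; [exact: path_edge | set_tac].
    - have ? : t2 <> d1 by move=> ?; subst; case: (path_ends pX) => h _; set_tac.
      by case: (J1) => *; set_tac.
  have [p|[p|p]] := IH D1 d1 s1 t1 (leq_trans (joined_proper (joined213 J1)) ltn) (jtB J1) (jB J1) h1 h2 e1 e2 n3.
  - by left; apply: ext.
  - by right; left; apply: ext.
  - right; right.
    have -> : U = D1 :|: (A :|: [set d1] :|: D2).
      rewrite (jU J1); apply/setP=> z; rewrite !inE; case: eqVneq => [->|_]; last by do !case: (_ \in _).
      by rewrite (jB J1) ?orbT.
    apply: (splits_glue p); case: (J1) => *; set_tac.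
    by apply: (@tree_set3 _ _ _ b d1 d2) => //; set_tac; constructor.
have swap : avoiding_path U b t s \/ avoiding_path U b s t \/ splits U b t s ->
   avoiding_path U b s t \/ avoiding_path U b t s \/ splits U b s t.
  move=> [?|[?|[W [S [T [w [J1 bW]]]]]]]; [by right; left|by left|].
  by right; right; exists W, T, S, w; split=> //; apply: joined132.
move: (sU) (tU'); rewrite {1 2}(jU J) => /setUP [/setUP [hs|hs]|hs] /setUP [/setUP [ht|ht]|ht].
- have [p|[p|[W [S [T [w [J1 bW]]]]]]] := IH A b s t (leq_trans (joined_proper J) ltn) (jtA J) (jA J) hs ht nbs nbt nst.
  + by left; case: p => X [? ? ?]; exists X; split=> //; rewrite (jU J); set_tac.
  + by right; left; case: p => X [? ? ?]; exists X; split=> //; rewrite (jU J); set_tac.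
  + right; right; exists (W :|: ([set b] :|: D :|: D')), S, T, w; split; last by set_tac.
    have -> : U = A :|: ([set b] :|: D :|: D').
      rewrite (jU J); apply/setP=> z; rewrite !inE; case: eqVneq => [->|_]; last by do !case: (_ \in _).
      by rewrite (jA J) ?orbT.
    apply: (joined_glueAr J1 _ bW _ _); case: (J) => *; set_tac.
    by apply: (@tree_set3 _ _ _ b d d') => //; set_tac; constructor.
- by left; apply: inA (hs) _; case: (J) => *; set_tac.
- by left; apply: inA (hs) _; case: (J) => *; set_tac.
- by right; left; apply: inA (ht) _; case: (J) => *; set_tac.
- by apply: both (J) (hs) (ht) _ _ _.
- by apply: mixed (J) (hs) (ht) _ _.
- by right; left; apply: inA (ht) _; case: (J) => *; set_tac.
- by apply: swap; apply: mixed (J) (ht) (hs) _ _.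
- by apply: both (joined132 J) (hs) (ht) _ _ _.
Qed.
End TreeSets.

(** * Closing a path to a linear cycle *)

Section Cycle.
Variables (V : finType) (H : hypergraph3 V).
Implicit Types (X Y : {set V}) (a b c u v y : V) (h f : {set V}) (s : seq ({set V} * V)).

Definition path_cover s := \bigcup_(e <- s) e.1.
(** Explicit edge sequences, each edge paired with the vertex at which it is left.
    Requiring an edge to meet the union of all later edges in one vertex only
    gives both the intersections of consecutive edges and the disjointness of
    the others. *)
Fixpoint chain a s : Prop :=
  if s is (h, b) :: s' then
    [/\ h \in edges H, a \in h, b \in h, a <> b & meets_at h (path_cover s') b] /\ chain b s'
  else True.
Definition vert a s i := nth a (a :: map snd s) i.
Definition nth_edge s i := nth set0 (map fst s) i.

Lemma path_cover_cons h b s : path_cover ((h, b) :: s) = h :|: path_cover s.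
Proof. by rewrite /path_cover big_cons. Qed.
Lemma path_cover_cat s1 s2 : path_cover (s1 ++ s2) = path_cover s1 :|: path_cover s2.
Proof. by rewrite /path_cover big_cat. Qed.
Lemma path_cover0 : path_cover [::] = set0.
Proof. by rewrite /path_cover big_nil. Qed.

Lemma nth_edge_cover s i : i < size s -> {subset nth_edge s i <= path_cover s}.
Proof.
elim: s i => [|[h b] s IH] [|i] //= lti z zi; rewrite path_cover_cons inE.
  by rewrite zi.
by rewrite (IH i) ?orbT.
Qed.

Lemma chain_end a s : chain a s -> s <> [::] -> last a (map snd s) \in path_cover s.
Proof.
elim: s a => [|[h b] s IH] a //= [[_ _ hb _ _] cs] _; rewrite path_cover_cons inE.
by case: s IH cs => [|e s] IH cs; [rewrite hb | rewrite (IH b) ?orbT].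
Qed.

Lemma chain_cat a s1 s2 : chain a s1 -> chain (last a (map snd s1)) s2 ->
  meets_at (path_cover s1) (path_cover s2) (last a (map snd s1)) -> chain a (s1 ++ s2).
Proof.
elim: s1 a => [|[h b] s1 IH] a //= [[hE ah bh ab m] c1] c2 m12.
rewrite path_cover_cons in m12; split; last by apply: IH => // z z1 z2; apply: m12; rewrite // inE z1 orbT.
split=> // z zh; rewrite path_cover_cat => /setUP [z1|z2]; first exact: m.
have zl : z = last b (map snd s1) by apply: m12; rewrite // inE zh.
case: s1 {IH} m c1 zl {m12 c2} => [|e s1] // m c1 zl.
by apply: m => //; rewrite zl; apply: chain_end.
Qed.

Lemma path_chain X a b : linear_path H X a b ->
  (a = b /\ X = [set a]) \/ exists s, [/\ s <> [::], chain a s, path_cover s = X & last a (map snd s) = b].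
Proof.
elim=> {X a b} [a|a b c e|X Y a b c _ IH1 _ IH2 m]; first by left.
  right; exists [:: ([set a; b; c], b)]; rewrite /= path_cover_cons path_cover0 setU0; split=> //.
  have [ab _ _] := triple_distinct e.
  by split=> //; split=> //; [mem_tac|mem_tac|move=> z _; rewrite inE].
case: IH1 IH2 m => [[<- ->] [[<- ->] _|[s [s0 cs <- es]] m]|[s [s0 cs <- es]] [[<- ->] m|[s' [s0' cs' <- es']] m]].
- by left; rewrite setUid.
- right; exists s; split=> //; apply/esym/setUidPr; rewrite sub1set.
  by case: s s0 cs {es m} => [|[h b1] s] // _ [[_ ah _ _ _] _]; rewrite path_cover_cons inE ah.
- right; exists s; split=> //; apply/esym/setUidPl; rewrite sub1set -es; exact: chain_end.
- right; exists (s ++ s'); split.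
  + by case: s s0 {cs es m}.
  + by apply: chain_cat; rewrite // es.
  + by rewrite path_cover_cat.
  + by rewrite map_cat last_cat es.
Qed.

Lemma chain_nth a s : chain a s -> forall i, i < size s ->
  [/\ nth_edge s i \in edges H, vert a s i \in nth_edge s i, vert a s i.+1 \in nth_edge s i & vert a s i <> vert a s i.+1]
  /\ forall j, i < j < size s -> meets_at (nth_edge s i) (nth_edge s j) (vert a s i.+1).
Proof.
elim: s a => [|[h b] s IH] a //= [[hE ah bh ab m] cs] [|i] lti.
  split; first by split.
  by case=> [|j] //= ltj z z1 z2; apply: m z1 _; apply: (nth_edge_cover (i := j)).
have [[h1 h2 h3 h4] h5] := IH b cs i lti.
have ev k : k <= size s -> vert a ((h, b) :: s) k.+1 = vert b s k.
  by move=> lek; rewrite /vert /=; apply: set_nth_default; rewrite /= size_map.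
rewrite !ev //; last exact: ltnW.
split; first by split.
by case=> [|j] //= ltj; apply: h5.
Qed.

(** An edge that meets a chain of at least two edges exactly in the two ends turns
    it into a linear cycle. Chains with a single edge are excluded: the
    closing edge would share two vertices with it. *)
Lemma chain_close a s f : chain a s -> 1 < size s -> f \in edges H -> a \in f ->
  last a (map snd s) \in f -> (forall z, z \in f -> z \in path_cover s -> z = a \/ z = last a (map snd s)) ->
  has_linear_cycle H.
Proof.
move=> cs m2 fE af cf ff.
set m := size s in m2 *.
have cn := chain_nth cs.
have elast : last a (map snd s) = vert a s m.
  by have := nth_last a (a :: map snd s); rewrite /= size_map => <-.
rewrite elast in cf ff.
have vE i j : i < j < m -> vert a s i \notin nth_edge s j.
  move=> /andP [ij jm]; have [[_ v1 _ v3] mm] := cn i (ltn_trans ij jm).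
  by apply/negP=> v2; apply: v3; apply: (mm j) => //; rewrite ij.
have vinj i j : i < j <= m -> vert a s i <> vert a s j.
  case: j => // j /andP [ij jm].
  have [[_ v1 v2 v3] _] := cn j jm.
  have [->//|ne] := eqVneq i j.
  have /negP h : vert a s i \notin nth_edge s j by apply: vE; lia.
  by move=> e; apply: h; rewrite e.
have ee i j : i.+1 < j < m -> apart (nth_edge s i) (nth_edge s j).
  move=> /andP [ij jm] z z1 z2.
  have [_ mm] := cn i ltac:(lia).
  have zv := mm j ltac:(lia) z z1 z2.
  have /negP := vE i.+1 j ltac:(lia); apply; by rewrite -zv.
pose hh i := if i < m then nth_edge s i else f.
have fi i z : i < m -> z \in f -> z \in nth_edge s i -> (z = vert a s 0 /\ i = 0) \/ (z = vert a s m /\ i = m.-1).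
  move=> im zf zi; case: (ff z zf (nth_edge_cover im zi)) => [za|zc].
    left; split=> //; case: (posnP i) => // i0.
    by have /negP[] := vE 0 i ltac:(lia); rewrite /vert /= -za.
  right; split=> //; apply/eqP; apply: contraT => ne.
  have [[_ v1 v2 v3] _] := cn m.-1 ltac:(lia).
  have [_ mm] := cn i im.
  have e := mm m.-1 ltac:(lia) z zi; rewrite prednK in v2; last by lia.
  have := vinj i.+1 m ltac:(lia); rewrite -zc => -[]; apply/esym/e; by rewrite zc.
exists m.+1, (fun i : 'I_m.+1 => vert a s i), (fun i : 'I_m.+1 => hh i); split; first by lia.
have hinj i j : i < j <= m -> hh i <> hh j.
  rewrite /hh => /andP [ij jm]; rewrite (leq_trans ij jm).
  have [[_ v1 v2 v3] _] := cn i (leq_trans ij jm).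
  case: (ltnP j m) => ltj e.
    by have /negP[] := vE i j ltac:(lia); rewrite -e.
  case: (fi i _ (leq_trans ij jm) _ v2) => [|[h _]|[h ?]]; first by rewrite -e.
    by apply: (vinj 0 i.+1) => //; lia.
  case: (fi i _ (leq_trans ij jm) _ v1) => [|[h' ?]|[h' ?]]; first by rewrite -e.
    by lia.
  by apply: (vinj i m) => //; lia.
have vf0 : hh 0 :&: f = [set vert a s 0].
  rewrite /hh; have -> : 0 < m by lia.
  apply/setP=> z; rewrite !inE; apply/andP/eqP => [[z1 z2]|->].
    by case: (fi 0 z ltac:(lia) z2 z1) => [[]|[_ ?]] //; lia.
  by have [[_ ->]] := cn 0 ltac:(lia).
have vfm : nth_edge s m.-1 :&: f = [set vert a s m].
  apply/setP=> z; rewrite !inE; apply/andP/eqP => [[z1 z2]|->].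
    by case: (fi m.-1 z ltac:(lia) z2 z1) => [[_ ?]|[]] //; lia.
  by have [[_ _]] := cn m.-1 ltac:(lia); rewrite prednK; [|lia].
have adj i : i.+1 <= m -> hh i :&: hh i.+1 = [set vert a s i.+1].
  rewrite /hh => im; rewrite im; case: (ltnP i.+1 m) => ltj; last first.
    have -> : i = m.-1 by lia.
    by rewrite vfm; have -> : m.-1.+1 = m by lia.
  apply/setP=> z; rewrite !inE; apply/andP/eqP => [[z1 z2]|->].
    by have [_ mm] := cn i im; apply: (mm i.+1) => //; lia.
  by have [[_ _ -> _] _] := cn i im; have [[_ -> _ _] _] := cn i.+1 ltj.
have far i j : i < j <= m -> 1 < j - i < m -> hh i :&: hh j = set0.
  move=> ij dj; apply/setP=> z; rewrite !inE /hh; apply/negP=> /andP [].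
  have -> : i < m by lia.
  case: (ltnP j m) => ltj z1 z2.
    by apply: (ee i j _ z); lia.
  by case: (fi i z ltac:(lia) z2 z1) => [[_ ?]|[_ ?]]; lia.
split.
- split=> i j e; apply/val_inj; case: (ltngtP i j) => // lt; exfalso.
  + by apply: (vinj i j) => //; have := ltn_ord j; lia.
  + by apply: (vinj j i) => //; have := ltn_ord i; lia.
  + by apply: (hinj i j) => //; have := ltn_ord j; lia.
  + by apply: (hinj j i) => //; have := ltn_ord i; lia.
- by move=> i; rewrite /hh; case: ifP => // im; have [[]] := cn i im.
- by move=> i j e; rewrite e; apply: adj; rewrite -e -ltnS.
- by move=> i j -> ->; rewrite /= {2}/hh ltnn.
- move=> i j; case: (ltngtP i j) => [ij|ij|->] d; last by lia.
  + by apply: far; have := ltn_ord j; lia.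
  + by rewrite setIC; apply: far; have := ltn_ord i; lia.
Qed.

(** The form in which linear cycles are excluded below: the intermediate vertex
    [m], distinct from both ends, guarantees that the path has at least two
    edges. *)
Lemma close_path X Y y m u v : ~ has_linear_cycle H -> linear_path H X y m -> linear_path H Y m u -> y <> m -> m <> u ->
  meets_at X Y m -> triple H y u v -> v \notin X -> v \notin Y -> False.
Proof.
move=> nc pX pY nym nmu mXY e vX vY; apply: nc.
case: (path_chain pX) => [[//]|[s1 [s1n c1 e1 l1]]].
case: (path_chain pY) => [[//]|[s2 [s2n c2 e2 l2]]].
apply: (@chain_close y (s1 ++ s2) [set y; u; v]) => //.
- by apply: chain_cat; rewrite // l1 ?e1 ?e2.
- by rewrite size_cat; case: (s1) s1n => // ? ? _; case: (s2) s2n => // ? ? _ /=; lia.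
- by mem_tac.
- by rewrite map_cat last_cat l1 l2; mem_tac.
- move=> z; rewrite map_cat last_cat l1 l2 path_cover_cat e1 e2.
  by case/setUP=> [/setUP [/set1P ->|/set1P ->]|/set1P ->] h; [left|right|set_tac].
Qed.
End Cycle.

(** * Private edges at the leaves of spanning trees *)

Section LeafClosing.
Variables (V : finType) (H : hypergraph3 V).
Implicit Types (A B C D P Q R S T U W X Y Z : {set V}) (a b c d p q r s t u v w x y z : V).
Local Notation triple := (triple H).
Local Notation linear_path := (linear_path H).
Local Notation tree_set := (tree_set H).
Local Notation joined := (joined H).
Local Notation splits := (splits H).
Hypothesis nc : ~ has_linear_cycle H.

(** An edge [yst] whose vertices [s] and [t] lie in a tree that is reached from
    [y] only through [b]. A path from [b] to one of [s], [t] avoiding the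
    other would close a linear cycle, so both lie behind the same tree edge. *)
Lemma forced_split B Y y b s t : tree_set B -> linear_path Y y b -> b \in B -> y <> b -> meets_at Y B b ->
  s \in B -> t \in B -> s <> b -> t <> b -> triple y s t -> splits B b s t.
Proof.
move=> tB pY bB nyb m sB tB' nsb ntb e.
have [_ _ nst] := triple_distinct e.
have no s1 t1 : t1 \in B -> t1 <> b -> s1 <> b -> triple y s1 t1 -> ~ avoiding_path H B b s1 t1.
  move=> t1B n1 n2 e1 [X [sX pX nX]].
  by apply: (close_path nc pY pX nyb _ _ e1 _ nX); [congruence | set_tac | set_tac].
have [||p|[p|//]] := split_or_path tB bB sB tB' _ _ nst; [congruence|congruence| | ].
- by case: (no s t tB' ntb nsb e p).
- by case: (no t s sB nsb ntb (triple132 e) p).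
Qed.

(** In every spanning tree of [U] in which [y] is a leaf on the edge [ybc], some
    edge inside [U] meets [ybc] in [y] only. The root [r] is exempt, so that a
    part of [U] hanging at a cut vertex can satisfy the condition although the
    edges closing at the cut vertex may leave the part. *)
Definition leaf_closing U r := forall y B b C c, joined U [set y] y B b C c -> y <> r ->
  exists u v, [/\ u \in U, v \in U, u <> b /\ u <> c, v <> b /\ v <> c & triple y u v].

(** A leaf [y] of a tree on [A] at which no edge closes inside [A] is also a leaf
    of the tree on [U] obtained by hanging [R] at [a]. The edge that closes
    there has a vertex in [R]; its other vertex lies in [R] too, since a path
    inside [A] would otherwise close a linear cycle. *)
Lemma escaping_edge U r A a R : leaf_closing U r -> tree_set A -> tree_set R -> a \in A -> a \in R -> meets_at A R a ->
  U = A :|: R -> r \in R -> ~ leaf_closing A a ->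
  exists y u v, [/\ y \in A, y <> a, u \in R, v \in R & [/\ u <> a, v <> a & triple y u v]].
Proof.
move=> gU tA tR aA aR m eU rR ng; apply: NNPP => nex; apply: ng.
have key y B b C c : joined A [set y] y B b C c -> y <> a -> a \in B ->
  exists u v, [/\ u \in A, v \in A, u <> b /\ u <> c, v <> b /\ v <> c & triple y u v].
  move=> J nya aB.
  have yA : y \in A by rewrite (jU J); mem_tac.
  have nyr : y <> r by move=> ?; subst; set_tac.
  have mR : meets_at R A a by set_tac.
  have J' : joined U [set y] y (B :|: R) b C c.
    rewrite eU setUC setUC (setUC B); apply: joined213.
    by rewrite (setUC A); apply: joined_glueA (joined213 J) tR aB aR mR.
  have [u [v [uU vU [nub nuc] [nvb nvc] e]]] := gU y _ b C c J' nyr.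
  have [nyu nyv nuv] := triple_distinct e.
  have side u1 v1 : u1 \in U -> v1 \in U -> u1 <> b -> u1 <> c -> v1 <> b -> v1 <> c -> triple y u1 v1 -> u1 \in A.
    move=> u1U v1U n1 n2 n3 n4 e1; apply: contraT => u1A.
    have u1R : u1 \in R by move: u1U; rewrite eU => /setUP [h|//]; set_tac.
    have nu1a : u1 <> a by move=> ?; subst; set_tac.
    have [m1 m2 _] := triple_distinct e1.
    have bypath D d D' d' : joined A [set y] y D d D' d' -> v1 \in D -> v1 <> d -> u1 <> d -> u1 <> d' -> False.
      move=> J1 h1 h2 h3 h4; have [X [sX pX]] := tree_set_path (jtB J1) (jB J1) h1.
      apply: (close_path nc (path_edge (jE J1)) pX _ _ _ (triple132 e1)).
      - by case: (triple_distinct (jE J1)).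
      - congruence.
      - by case: J1 => *; set_tac.
      - by set_tac.
      - by case: J1 => *; subst; set_tac.
    case: (boolP (v1 \in A)) => [v1A|v1A].
      move: (v1A); rewrite {1}(jU J) => /setUP [/setUP [/set1P ?|h]|h]; first by subst.
      + by case: (bypath _ _ _ _ J h).
      + by case: (bypath _ _ _ _ (joined132 J) h).
    have v1R : v1 \in R by move: v1U; rewrite eU => /setUP [h|//]; set_tac.
    case: nex; exists y, u1, v1; split=> //; split=> //.
    by move=> ?; subst; set_tac.
  exists u, v; split=> //; first exact: (side u v).
  by apply: (side v u) => //; apply: triple132.
move=> y B b C c J nya.
move: (aA); rewrite {1}(jU J) => /setUP [/setUP [/set1P ?|h]|h]; first by subst.
- exact: key J nya h.
- have [u [v [? ? [? ?] [? ?] ?]]] := key _ _ _ _ _ (joined132 J) nya h.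
  by exists u, v.
Qed.

End LeafClosing.

(** * A minimal leaf-closing set has five vertices *)

Section MinimalCounterexample.
Variables (V : finType) (H : hypergraph3 V).
Implicit Types (A B C D P Q R S T W X Y Z : {set V}) (a b c d p q s t u v w x y z : V).
Local Notation triple := (triple H).
Local Notation linear_path := (linear_path H).
Local Notation tree_set := (tree_set H).
Local Notation joined := (joined H).
Local Notation splits := (splits H).
Local Notation leaf_closing := (leaf_closing H).
Hypothesis nc : ~ has_linear_cycle H.
Variables (U : {set V}) (r : V).
Hypotheses (tU : tree_set U) (rU : r \in U) (gU : leaf_closing U r).
Hypothesis IH : forall A a, #|A| < #|U| -> tree_set A -> a \in A -> leaf_closing A a -> A = [set a].

Lemma escaping_edge_small A a R : tree_set A -> tree_set R -> a \in A -> a \in R -> meets_at A R a ->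
  U = A :|: R -> r \in R -> A <> [set a] -> R <> [set a] ->
  exists y u v, [/\ y \in A, y <> a, u \in R, v \in R & [/\ u <> a, v <> a & triple y u v]].
Proof.
move=> tA tR aA aR m eU rR nA nR; apply: (escaping_edge nc gU) => // gA; apply: nA; apply: IH => //.
have [z zR nz] := set_other aR nR.
rewrite eU; apply: proper_card; apply/properP; split; first exact: subsetUl.
by exists z; [mem_tac | set_tac].
Qed.

(** Choose an edge at [r] for which the branch [A] hanging at [r] itself is
    smallest. If [A] is not trivial, an edge escapes from the rest of [U] into
    [A], and exchanging branches along it makes [A] smaller. *)
Lemma root_is_leaf : U <> [set r] ->
  exists B b C c, joined U [set r] r B b C c.
Proof.
move=> nU.
have [|A [[B [b [C [c J]]]] mA]] := @ex_min_measure _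
   (fun A => exists B b C c, joined U A r B b C c) (fun A => #|A|).
  by have [//|[A [B [b [C [c J]]]]]] := root_split tU rU; exists A, B, b, C, c.
have [eA|nA] := classic (A = [set r]); first by exists B, b, C, c; rewrite -eA.
have tR : tree_set ([set r] :|: B :|: C).
  by case: (J) => *; apply: (@tree_set3 _ _ _ _ _ r b c) => //; set_tac; constructor.
have [|||||||y [u [v [yR nyr uA vA [nur nvr e]]]]] := @escaping_edge_small ([set r] :|: B :|: C) r A tR (jtA J).
- by mem_tac.
- by case: J.
- by case: (J) => *; set_tac.
- rewrite (jU J); apply/setP=> z; rewrite !inE; case: eqVneq => [->|_]; last by do !case: (_ \in _).
  by rewrite (jA J).
- by case: J.
- by move=> eR; move: (jB J) (jE J); have : b \in [set r] :|: B :|: C by [case: (J) => *; mem_tac]; rewrite eR => /set1P -> _ /triple_distinct [].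
- by [].
have rR : r \in [set r] :|: B :|: C by mem_tac.
have [Y [sY pY]] := tree_set_path tR yR rR.
have mY : meets_at Y A r by case: (J) => *; set_tac.
have [W [S [T [w [J1 rW]]]]] := forced_split nc (jtA J) pY (jA J) nyr mY uA vA nur nvr e.
exfalso; have : #|W| < #|A| := joined_proper J1.
rewrite ltnNge mA //.
move: yR => /setUP [/setUP [/set1P //|yB]|yC].
- exists (B :|: S :|: T), b, C, c.
  by have [/joined213/joined132/joined213 ? _] := joined_move (joined213 (joined132 (joined213 J))) J1 rW yB e.
- exists B, b, (C :|: S :|: T), c.
  by have [/joined132/joined213 ? _] := joined_move (joined132 (joined213 J)) J1 rW yC e.
Qed.

(** With [r] a leaf on an edge [rdc], choose the branch [D] at [d] as large as
    possible. Some edge [yuv] leaves [D]; if [u] and [v] both lay in the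
    branch at [c], an exchange would enlarge [D]. The only position of [u] and
    [v] that closes no linear cycle gives the edge [yrc]. *)
Lemma pseudo_cycle_exists : U <> [set r] ->
  exists Q q W w x, [/\ joined U [set r] r Q q W w, x \in W, x <> w & triple r q x].
Proof.
move=> nU.
have [|D [[d [C [c J]]] mD]] := @ex_max_card V (fun D => exists d C c, joined U [set r] r D d C c).
  by have [B [b [C [c J]]]] := root_is_leaf nU; exists B, b, C, c.
suff [y [yD nyd e]] : exists y, [/\ y \in D, y <> d & triple y r c].
  by exists C, c, D, d, y; split=> //; [apply: joined132 | apply: triple231 e].
have erdc := jE J; have [nrd nrc ndc] := triple_distinct erdc.
have [y [u [v [yD uR vR e ne]]]] : exists y u v, [/\ y \in D, u \in [set r] :|: C, v \in [set r] :|: C,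
    triple y u v & (y = d -> [/\ u <> r, u <> c, v <> r & v <> c])].
  have [eD|nD] := classic (D = [set d]).
    have J' : joined U [set d] d [set r] r C c by rewrite -{1}eD; apply: joined213.
    have [|u [v [uU vU [nur nuc] [nvr nvc] e]]] := gU J'; first by congruence.
    have [ndu ndv _] := triple_distinct e.
    exists d, u, v; split=> //; [by rewrite eD; mem_tac| |].
    - by move: uU; rewrite (jU J') => /setUP [/setUP [/set1P|/set1P]|uC] //; [congruence|mem_tac].
    - by move: vU; rewrite (jU J') => /setUP [/setUP [/set1P|/set1P]|uC] //; [congruence|mem_tac].
  have tR : tree_set ([set d] :|: [set r] :|: C).
    by case: (J) => *; apply: (@tree_set3 _ _ _ _ _ d r c) => //; set_tac; try constructor; apply: triple213.
  have [||||||y [u [v [yD nyd uR vR [nu nv e]]]]] := @escaping_edge_small D d ([set d] :|: [set r] :|: C) (jtB J) tR (jB J).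
  - by mem_tac.
  - by case: (J) => *; set_tac.
  - rewrite (jU J); apply/setP=> z; rewrite !inE; case: (eqVneq z d) => [->|_]; last by do !case: (_ \in _); case: (_ == _).
    by rewrite (jB J) !orbT.
  - by mem_tac.
  - by [].
  - by move=> eR; have : r \in [set d] by [rewrite -eR; mem_tac]; move/set1P.
  exists y, u, v; split=> //.
  - by move: uR => /setUP [/setUP [/set1P|/set1P ->]|uC] //; mem_tac.
  - by move: vR => /setUP [/setUP [/set1P|/set1P ->]|uC] //; mem_tac.
have [Y [sY pY]] := tree_set_path (jtB J) yD (jB J).
have thru_r v1 : y <> d -> v1 \in C -> triple y r v1 -> v1 = c.
  move=> nyd v1C e1; apply: NNPP => nv1c.
  by apply: (close_path nc pY (path_edge (triple213 erdc)) nyd _ _ e1); case: (J) => *; set_tac.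
have edcr := triple132 (triple213 erdc).
have thru_c v1 : y <> d -> v1 \in C -> ~ triple y c v1.
  move=> nyd v1C e1; have [_ _ ncv] := triple_distinct e1.
  by apply: (close_path nc pY (path_edge edcr) nyd _ _ e1); case: (J) => *; set_tac.
have [Y' [pY' mY']] : exists Y', linear_path Y' y c /\ meets_at Y' C c.
  have [eyd|nyd] := classic (y = d).
    by exists [set d; c; r]; subst y; split; [apply: path_edge | case: (J) => *; set_tac].
  exists (Y :|: [set d; c; r]); split; last by case: (J) => *; set_tac.
  by apply: path_cat pY (path_edge edcr) _; case: (J) => *; set_tac.
have within u1 v1 : u1 \in C -> v1 \in C -> u1 <> c -> v1 <> c -> ~ triple y u1 v1.
  move=> u1C v1C n1 n2 e1.
  have nyc : y <> c by case: (J) => *; set_tac.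
  have [W [S [T [w [J1 cW]]]]] := forced_split nc (jtC J) pY' (jC J) nyc mY' u1C v1C n1 n2 e1.
  have [J2] := joined_move J J1 cW yD e1.
  by rewrite ltnNge mD //; exists d, W, c.
have [_ _ nuv] := triple_distinct e.
case/setUP: uR => [/set1P ?|uC]; case/setUP: vR => [/set1P ?|vC]; subst.
- by [].
- have nyd : y <> d by move=> /ne [].
  by exists y; split=> //; rewrite -(thru_r v nyd vC e).
- have nyd : y <> d by move=> /ne [_ _].
  by exists y; split=> //; rewrite -(thru_r u nyd uC (triple132 e)); apply: triple132.
- have [?|nuc] := classic (u = c).
    by subst u; case: (thru_c v _ vC e) => /ne [].
  have [?|nvc] := classic (v = c); last by case: (within u v).
  by subst v; case: (thru_c u _ uC (triple132 e)) => /ne [].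
Qed.

(** A path from [w] to [x] in [W] with both ends joined to the pair [rq]: the two
    joining edges share two vertices, so this closed structure is not a linear
    cycle. *)
Definition pseudo_cycle Q q W w x := [/\ joined U [set r] r Q q W w, x \in W, x <> w & triple r q x].

(** Take a pseudo-cycle with [W] smallest. If the branch [Q] is not trivial, an
    edge escapes from [Q] into [W]; splitting [W] there, both [w] and [x] stay
    on the same side, for [rqx] would otherwise lead behind the split, and
    moving the branches to [Q] makes [W] smaller. All other pseudo-cycles then
    have a trivial [Q] as well, by counting vertices. *)
Lemma hub_single Q q W w x : pseudo_cycle Q q W w x -> Q = [set q].
Proof.
move=> pc0.
have [|W1 [[Q1 [q1 [w1 [x1 [J xW nxw ex]]]]] mW]] := @ex_min_measure _
   (fun W => exists Q q w x, pseudo_cycle Q q W w x) (fun W => #|W|); first by exists W, Q, q, w, x.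
(* A pseudo-cycle with a larger branch at q would have a smaller W. *)
suff eQ1 : Q1 = [set q1].
  case: (pc0) => J0 _ _ _; have := mW W ltac:(by exists Q, q, w, x).
  have := joined_card J; rewrite (joined_card J0) eQ1 !cards1 => e1 e2.
  apply/esym/eqP; rewrite eqEcard sub1set (jB J0) cards1 /=; lia.
move: {Q q W w x pc0} Q1 q1 W1 w1 x1 J xW nxw ex mW => Q q W w x J xW nxw ex mW.
apply: NNPP => nQ.
have erqw := jE J; have [nrq nrw nqw] := triple_distinct erqw.
have [_ nrx nqx] := triple_distinct ex.
have tR : tree_set ([set q] :|: [set r] :|: W).
  by case: (J) => *; apply: (@tree_set3 _ _ _ _ _ q r w) => //; set_tac; try constructor; apply: triple213.
have [||||||y [u [v [yQ nyq uR vR [nuq nvq e]]]]] := @escaping_edge_small Q q ([set q] :|: [set r] :|: W) (jtB J) tR (jB J).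
- by mem_tac.
- by case: (J) => *; set_tac.
- rewrite (jU J); apply/setP=> z; rewrite !inE; case: (eqVneq z q) => [->|_]; last by do !case: (_ \in _); case: (_ == _).
  by rewrite (jB J) !orbT.
- by mem_tac.
- by [].
- by move=> eR; have : r \in [set q] by [rewrite -eR; mem_tac]; move/set1P.
have [Y [sY pY]] := tree_set_path (jtB J) yQ (jB J).
have [_ _ nuv] := triple_distinct e.
(* For v1 = w the edge rqw contains v1, so the cycle is closed along rqx. *)
have thru_r v1 : v1 \in W -> ~ triple y r v1.
  move=> v1W e1; have [?|nv1w] := classic (v1 = w).
    by subst v1; apply: (close_path nc pY (path_edge (triple213 ex)) nyq _ _ e1); case: (J) => *; set_tac.
  by apply: (close_path nc pY (path_edge (triple213 erqw)) nyq _ _ e1); case: (J) => *; set_tac.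
have eqwr := triple132 (triple213 erqw); have eqxr := triple132 (triple213 ex).
have thru_w v1 : v1 \in W -> ~ triple y w v1.
  move=> v1W e1; have [_ _ nwv] := triple_distinct e1.
  by apply: (close_path nc pY (path_edge eqwr) nyq _ _ e1); case: (J) => *; set_tac.
have within u1 v1 : u1 \in W -> v1 \in W -> u1 <> w -> v1 <> w -> ~ triple y u1 v1.
  move=> u1W v1W n1 n2 e1.
  have [W0 [S [T [w0 [J1 wW0]]]]] : splits W w u1 v1.
    apply: (forced_split nc (jtC J) (path_cat pY (path_edge eqwr) _) _ _ _ u1W v1W n1 n2 e1); case: (J) => *; set_tac.
  have meet_x D D' u2 v2 : joined W D u2 W0 w0 D' v2 -> x \in D -> ~ triple y u2 v2.
    move=> J2 xD e2; have [X [sX pX]] := tree_set_path (jtA J2) xD (jA J2).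
    apply: (close_path nc pY (path_edge_cons eqxr pX _ _) nyq _ _ e2); case: (J) (J2) => ? ? ? ? ? ? ? ? ? ? ? [*]; subst; set_tac.
  move: (xW); rewrite {1}(jU J1) => /setUP [/setUP [xW0|xS]|xT].
  - have := joined_proper J1; rewrite ltnNge mW //; exists (Q :|: S :|: T), q, w, x; split=> //.
    by case: (joined_move J J1 wW0 yQ e1).
  - by case: (meet_x _ _ _ _ (joined213 J1) xS).
  - by case: (meet_x _ _ _ _ (joined213 (joined132 J1)) xT); apply: triple132.
case/setUP: uR => [/setUP [/set1P ?|/set1P ?]|uC]; case/setUP: vR => [/setUP [/set1P ?|/set1P ?]|vC] //; subst => //.
- by case: (thru_r v).
- by case: (thru_r u); last apply: triple132.
- have [?|nuw] := classic (u = w); first by subst u; case: (thru_w v).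
  have [?|nvw] := classic (v = w); first by subst v; case: (thru_w u); last apply: triple132.
  by case: (within u v).
Qed.

Section Hub.
Variables (q : V) (W : {set V}).
Hypotheses (tW : tree_set W) (rW : r \notin W) (qW : q \notin W) (nrq : r <> q).
Hypothesis eUW : U = [set r] :|: [set q] :|: W.

Lemma hub_joined w : w \in W -> triple r q w -> joined U [set r] r [set q] q W w.
Proof. by move=> wW e; split=> //; try exact: tree_set1; set_tac. Qed.

(** If [w] and [x] stayed together after moving the branches at [u] and [v] to
    [q], they would form a pseudo-cycle whose branch at [q] is not trivial. *)
Lemma hub_at_most_one W0 w0 S u T v w x : joined W W0 w0 S u T v -> w \in W0 -> x \in W0 -> x <> w ->
  triple r q w -> triple r q x -> triple q u v -> False.
Proof.
move=> J wW0 xW0 nxw ew ex e.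
have wW : w \in W by case: (joined_subs J) => s1 _ _; apply: s1.
have [J1 lt] := joined_move (hub_joined wW ew) J wW0 (set11 q) e.
by move: lt; rewrite (@hub_single ([set q] :|: S :|: T) q W0 w x) ?ltnn.
Qed.

(** The edge closing at the leaf [q] splits [W] by [forced_split]. A vertex [x]
    joined to [rq] lies behind the split by [hub_at_most_one], and equals [s]
    or [t], since a path from [q] through [rqx] to [s] or [t] would otherwise
    close a linear cycle with [qst]. *)
Lemma hub_split w : w \in W -> triple r q w -> exists W0 w0 S s T t,
  [/\ joined W W0 w0 S s T t, w \in W0, triple q s t & forall x, x \in W -> triple r q x -> x <> w -> x = s \/ x = t].
Proof.
move=> wW e; have J := hub_joined wW e.
have [|s [t [sU tU' [nsr nsw] [ntr ntw] e1]]] := gU (joined213 J); first by congruence.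
have [nqs nqt _] := triple_distinct e1; have [_ nrw nqw] := triple_distinct e.
have sW : s \in W by move: sU; rewrite eUW => /setUP [/setUP [/set1P|/set1P]|]; congruence.
have tW' : t \in W by move: tU'; rewrite eUW => /setUP [/setUP [/set1P|/set1P]|]; congruence.
have eqwr := triple132 (triple213 e).
have mY : meets_at [set q; w; r] W w by set_tac.
have [W0 [S [T [w0 [J1 wW0]]]]] := forced_split nc tW (path_edge eqwr) wW nqw mY sW tW' nsw ntw e1.
exists W0, w0, S, s, T, t; split=> // x xW ex nxw.
have eqxr := triple132 (triple213 ex); have [nqx nqr nxr] := triple_distinct eqxr.
have hit D d D' d' : joined W D d W0 w0 D' d' -> x \in D -> triple q d d' -> x = d.
  move=> J2 xD e2; apply: NNPP => nxd.
  have [X [sX pX]] := tree_set_path (jtA J2) xD (jA J2).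
  have [sD _ sD'] := joined_subs J2; have d'D' := jC J2.
  have dD := jAC J2.
  by apply: (close_path nc (path_edge eqxr) pX nqx nxd _ e2); set_tac.
move: (xW); rewrite {1}(jU J1) => /setUP [/setUP [xW0|xS]|xT].
- by case: (hub_at_most_one J1 wW0 xW0 nxw e ex e1).
- by left; apply: hit (joined213 J1) xS e1.
- by right; apply: hit (joined213 (joined132 J1)) xT (triple132 e1).
Qed.

(** The pair [st] is joined to both [q] and [w0], and one of its vertices is
    joined to [rq]: from [s] there are routes to [r], [q], [w0] and [t] that
    leave enough room to close a linear cycle along an edge escaping from [S]. *)
Definition diamond W0 w0 S s T t w :=
  [/\ joined W W0 w0 S s T t, w \in W0, triple r q w, triple q s t & triple r q s \/ triple r q t].

(** Choose the diamond with [S] largest. If [S] is not trivial, an edge [yuv]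
    escapes from it; each position of [u] and [v] either closes a linear cycle
    along one of the routes leaving [s], or allows an exchange that enlarges
    [S]. *)
Lemma diamond_single W0 w0 S s T t w : diamond W0 w0 S s T t w -> S = [set s].
Proof.
move=> d0.
have [|S1 [[W1 [w1 [s1 [T1 [t1 [wr [J wW0 ew eq est]]]]]]] mS]] := @ex_max_card V
   (fun S => exists W0 w0 s T t w, diamond W0 w0 S s T t w); first by exists S, W0, w0, s, T, t, w.
suff eS1 : S1 = [set s1].
  have := mS S ltac:(by exists W0, w0, s, T, t, w); rewrite eS1 cards1 => le1.
  by case: d0 => J0 _ _ _ _; apply/esym/eqP; rewrite eqEcard sub1set (jB J0) cards1.
move: {W0 w0 S s T t w d0} W1 w1 S1 s1 T1 t1 wr J wW0 ew eq est mS => W0 w0 S s T t w J wW0 ew eq est mS.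
apply: NNPP => nS.
have ewst := jE J; have [nws nwt nst] := triple_distinct ewst.
have [nqs nqt _] := triple_distinct eq; have [_ nrw nqw] := triple_distinct ew.
have parts : [/\ apart W0 S, apart W0 T & apart S T] by case: J.
have [dWS dWT dST] := parts.
have subs : [/\ {subset W0 <= W}, {subset S <= W} & {subset T <= W}] by rewrite (jU J); split; set_tac.
have [sW0 sS sT] := subs.
have sinS := jB J; have tinT := jC J; have w0in := jA J.
have tR0 : tree_set ([set r] :|: [set q] :|: W0).
  by apply: (@tree_set3 _ _ _ _ _ r q w) => //; try exact: tree_set1; try exact: (jtA J); set_tac.
have tR : tree_set ([set s] :|: ([set r] :|: [set q] :|: W0) :|: T).
  by apply: (@tree_set3 _ _ _ _ _ s w0 t) => //; try exact: tree_set1; try exact: (jtC J); set_tac; apply: triple213.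
have [||||||y [u [v [yS nys uR vR [nus nvs e]]]]] := @escaping_edge_small S s _ (jtB J) tR sinS.
- by mem_tac.
- by set_tac.
- rewrite eUW (jU J); apply/setP=> z; rewrite !inE; case: (eqVneq z s) => [->|_]; last by do !case: (_ \in _); do ?case: (_ == _).
  by rewrite sinS !orbT.
- by mem_tac.
- by [].
- by move=> eR; have : r \in [set s] by [rewrite -eR; mem_tac]; move/set1P => ?; subst; set_tac.
have [Y [sY pY]] := tree_set_path (jtB J) yS sinS.
have [_ _ nuv] := triple_distinct e.
have Sr : r \notin S by set_tac.
have Sq : q \notin S by set_tac.
have Sw : w \notin S by set_tac.
have St : t \notin S by set_tac.
have Sw0 : w0 \notin S by set_tac.
have ntr : t <> r by set_tac.
have ntq : t <> q by set_tac.
have ntw : t <> w by set_tac.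
have ewq := triple132 ew; have eqr := triple213 ew.
(* A route from y through s along sab and X to c closes with an edge y c v1. *)
have cl a b X c v1 : triple s a b -> linear_path X a c -> apart S X -> b \notin S -> b \notin X ->
    v1 \notin S -> v1 \notin X -> v1 <> b -> triple y c v1 -> False.
  move=> e1 pX dX bS bX v1S v1X nv1b e2; have [aX cX] := path_ends pX.
  by apply: (close_path nc pY (path_edge_cons e1 pX _ bX) nys _ _ e2); set_tac.
have est' := triple231 ewst. have esqt := triple213 eq.
have Kq v1 : v1 \notin S -> ~ triple y q v1.
  move=> v1S e1; have [nyq nyv nqv] := triple_distinct e1.
  have [?|n] := classic (v1 = t).
    by subst v1; apply: (cl _ _ _ _ _ est' (path0 _ t) _ _ _ _ _ _ (triple132 e1)); set_tac.
  by apply: (cl _ _ _ _ _ esqt (path0 _ q) _ _ _ _ _ _ e1); set_tac.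
have Kt v1 : v1 \notin S -> ~ triple y t v1.
  move=> v1S e1; have [nyt nyv ntv] := triple_distinct e1.
  have [?|n] := classic (v1 = q); first by subst v1; apply: (Kq t) => //; apply: triple132.
  by apply: (cl _ _ _ _ _ (triple132 esqt) (path0 _ t) _ _ _ _ _ _ e1); set_tac.
have Kr v1 : v1 \in W -> v1 \notin S -> ~ triple y r v1.
  move=> v1W v1S e1; have [nyr nyv nrv] := triple_distinct e1.
  have [?|nvt] := classic (v1 = t); first by subst v1; apply: (Kt r) => //; apply: triple132.
  have nvq : v1 <> q by set_tac.
  case: est => [ers|ert].
    by apply: (cl _ _ _ _ _ (triple312 ers) (path0 _ r) _ _ _ _ _ _ e1); set_tac.
  have [?|nvw] := classic (v1 = w); last first.
    by apply: (cl _ _ _ _ _ esqt (path_edge eqr) _ _ _ _ _ _ e1); set_tac.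
  subst v1; have [?|nw0] := classic (w0 = w).
    by subst w0; apply: (cl _ _ _ _ _ (triple213 ewst) (path0 _ w) _ _ _ _ _ _ (triple132 e1)); set_tac.
  by apply: (cl _ _ _ _ _ est' (path_edge (triple312 ert)) _ _ _ _ _ _ e1); set_tac.
have KTW u1 v1 : u1 \in T -> v1 \in W0 -> ~ triple y u1 v1.
  move=> u1T v1W e1; have [X [sX pX]] := tree_set_path (jtC J) tinT u1T.
  by apply: (cl _ _ _ _ _ (triple132 esqt) pX _ _ _ _ _ _ e1); set_tac.
have KTT u1 v1 : u1 \in T -> v1 \in T -> ~ triple y u1 v1.
  move=> u1T v1T e1; have [?|nut] := classic (u1 = t); first by subst u1; apply: (Kt v1) => //; set_tac.
  have [?|nvt] := classic (v1 = t); first by subst v1; apply: (Kt u1); [set_tac | apply: triple132].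
  have [T0 [S' [T' [t0 [J1 tT0]]]]] : splits T t u1 v1.
    by apply: (forced_split nc (jtC J) (path_cat pY (path_edge (triple132 esqt)) _) tinT _ _ u1T v1T nut nvt e1); set_tac.
  have [J2] := joined_move J J1 tT0 yS e1.
  by rewrite ltnNge mS //; exists W0, w0, s, T0, t, w; split.
have Kw0 v1 : v1 \in W0 -> ~ triple y w0 v1.
  move=> v1W e1; have [_ _ n] := triple_distinct e1.
  by apply: (cl _ _ _ _ _ (triple213 ewst) (path0 _ w0) _ _ _ _ _ _ e1); set_tac.
have KWW u1 v1 : u1 \in W0 -> v1 \in W0 -> ~ triple y u1 v1.
  move=> u1W v1W e1; have [?|nut] := classic (u1 = w0); first by subst u1; apply: (Kw0 v1).
  have [?|nvt] := classic (v1 = w0); first by subst v1; apply: (Kw0 u1) => //; apply: triple132.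
  have [W' [S' [T' [w' [J1 w0W']]]]] : splits W0 w0 u1 v1.
    by apply: (forced_split nc (jtA J) (path_cat pY (path_edge (triple213 ewst)) _) w0in _ _ u1W v1W nut nvt e1); set_tac.
  have hit D d D' d' : joined W0 D d W' w' D' d' -> w \in D -> ~ triple y d d'.
    move=> J2 wD e2; have [X [sX pX]] := tree_set_path (jtA J2) wD (jA J2).
    have sD : {subset D <= W0} by rewrite (jU J2); set_tac.
    have d'W0 : d' \in W0 by rewrite (jU J2); case: (J2) => *; mem_tac.
    have d'D : d' \notin D by case: (J2) => *; set_tac.
    by apply: (cl _ _ _ _ _ esqt (path_edge_cons (triple132 eqr) pX _ _) _ _ _ _ _ _ e2); set_tac.
  move: (wW0); rewrite {1}(jU J1) => /setUP [/setUP [wW'|wS]|wT].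
  - have [J2] := joined_move (joined132 (joined213 (joined132 J))) J1 w0W' yS e1.
    rewrite ltnNge mS //; exists W', w0, s, T, t, w; split=> //.
    exact: joined213 (joined132 (joined213 J2)).
  - by case: (hit _ _ _ _ (joined213 J1) wS).
  - by case: (hit _ _ _ _ (joined213 (joined132 J1)) wT (triple132 e1)).
have nS1 x1 : x1 \in W0 \/ x1 \in T -> x1 \notin S by case=> h1; set_tac.
case/setUP: uR => [/setUP [/set1P //|/setUP [/setUP [/set1P ?|/set1P ?]|uC]]|uC];
case/setUP: vR => [/setUP [/set1P //|/setUP [/setUP [/set1P ?|/set1P ?]|vC]]|vC] //; subst => //.
- by apply: (Kq r) => //; apply: triple132.
- by apply: (Kr v) => //; auto.
- by apply: (Kr v) => //; auto.
- by apply: (Kq r).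
- by apply: (Kq v) => //; auto.
- by apply: (Kq v) => //; auto.
- by apply: (Kr u); auto; apply: triple132.
- by apply: (Kq u); auto; apply: triple132.
- by apply: (KWW u v).
- by apply: (KTW v u) => //; apply: triple132.
- by apply: (Kr u); auto; apply: triple132.
- by apply: (Kq u); auto; apply: triple132.
- by apply: (KTW u v).
- by apply: (KTT u v).
Qed.

(** The edge closing at the leaf [t] can only be [trq]: an edge into [W0] would
    close a linear cycle, or exchange branches so that the branch at [t] is no
    longer trivial, against [diamond_single]. *)
Lemma apex_other W0 w0 s t w : joined W W0 w0 [set s] s [set t] t -> w \in W0 ->
  triple r q w -> triple q s t -> triple r q s -> triple r q t.
Proof.
move=> J wW0 ew eq es.
have [sW0 sS sT] := joined_subs J.
have sW := sS _ (set11 s); have tW' := sT _ (set11 t); have wW := sW0 _ wW0.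
have W0s : s \notin W0 := apart1r (jAB J); have W0t : t \notin W0 := apart1r (jAC J).
have ewst := jE J; have [nws nwt nst] := triple_distinct ewst.
have [nqs nqt _] := triple_distinct eq; have [_ nrw nqw] := triple_distinct ew.
have w0W0 := jA J; have eqwr := triple132 (triple213 ew).
have tR0 : tree_set ([set r] :|: [set q] :|: W0).
  by apply: (@tree_set3 _ _ _ _ _ r q w) => //; try exact: tree_set1; try exact: (jtA J); set_tac.
have w0R : w0 \in [set r] :|: [set q] :|: W0 by mem_tac.
have etws : triple t w0 s by exact: triple312.
have J1 : joined U [set t] t ([set r] :|: [set q] :|: W0) w0 [set s] s.
  have eU : U = [set t] :|: ([set r] :|: [set q] :|: W0) :|: [set s] by rewrite eUW (jU J); set_eq_tac.
  by split=> //; try exact: tree_set1; try exact: set11; set_tac.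
have ntr : t <> r by set_tac.
have [u [v [uU vU [nuw nus] [nvw nvs] e]]] := gU J1 ntr.
have [ntu ntv nuv] := triple_distinct e.
have inR x : x \in U -> x <> s -> x <> t -> [\/ x = r, x = q | x \in W0].
  rewrite eUW (jU J) => /setUP [/setUP [/set1P|/set1P]|/setUP [/setUP [|/set1P]|/set1P]] h ? ? //;
  by [constructor 1|constructor 2|constructor 3].
have out a v1 : a \notin W -> v1 \in W0 -> v1 <> w0 -> ~ triple t v1 a.
  move=> aW v1W n e1; have [X [sX pX]] := tree_set_path (jtA J) w0W0 v1W.
  have na : a <> s by set_tac.
  by apply: (close_path nc (path_edge etws) pX _ _ _ e1); set_tac.
have within u1 v1 : u1 \in W0 -> v1 \in W0 -> u1 <> w0 -> v1 <> w0 -> ~ triple t u1 v1.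
  move=> u1W v1W n1 n2 e1.
  have ntw : t <> w0 by set_tac.
  have mY : meets_at [set t; w0; s] W0 w0 by set_tac.
  have [W' [S' [T' [w' [J2 w0W']]]]] := forced_split nc (jtA J) (path_edge etws) w0W0 ntw mY u1W v1W n1 n2 e1.
  have etqs : triple t q s by exact: triple312.
  have hit D d D' d' : joined W0 D d W' w' D' d' -> w \in D -> ~ triple t d d'.
    move=> J3 wD e2; have [X [sX pX]] := tree_set_path (jtA J3) wD (jA J3).
    have [sD _ sD'] := joined_subs J3; have d'D' := jC J3; have dinD := jA J3.
    have d'D : d' \notin D by have dD := jAC J3; set_tac.
    have d'W0 := sD' _ d'D'; have d'W := sW0 _ d'W0.
    by apply: (close_path nc (path_edge etqs) (path_edge_cons eqwr pX _ _) _ _ _ e2); set_tac.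
  move: (wW0); rewrite {1}(jU J2) => /setUP [/setUP [wW'|wS]|wT].
  - have [J3 lt] := joined_move (joined132 (joined213 J)) J2 w0W' (set11 t) e1.
    move: lt; rewrite (@diamond_single W' w0 ([set t] :|: S' :|: T') t [set s] s w) ?ltnn //.
    by split=> //; [exact: joined132 (joined213 (joined132 J3)) | apply: triple132 | right].
  - by case: (hit _ _ _ _ (joined213 J2) wS).
  - by case: (hit _ _ _ _ (joined213 (joined132 J2)) wT (triple132 e1)).
have [||ur|uq|uW] := inR u uU => //; try congruence.
all: have [||vr|vq|vW] := inR v vU => //; try congruence.
- by subst; apply: triple231.
- by subst u; case: (out r v rW vW nvw (triple132 e)).
- by subst; apply: triple321.
- by subst u; case: (out q v qW vW nvw (triple132 e)).
- by subst v; case: (out r u rW uW nuw e).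
- by subst v; case: (out q u qW uW nuw e).
- by case: (within u v).
Qed.

Lemma hub_apex w x : w \in W -> x \in W -> x <> w -> triple r q w -> triple r q x ->
  exists W0 w0 s t, [/\ joined W W0 w0 [set s] s [set t] t, w \in W0, triple q s t, triple r q s /\ triple r q t
    & forall z, z \in W -> triple r q z -> z <> w -> z = s \/ z = t].
Proof.
move=> wW xW nxw ew ex; have [W0 [w0 [S [s [T [t [J wW0 eq Z]]]]]]] := hub_split wW ew.
have est : triple r q s \/ triple r q t by case: (Z x xW ex nxw) => <-; [left|right].
have eS : S = [set s] by apply: (@diamond_single W0 w0 S s T t w); split.
have eT : T = [set t].
  by apply: (@diamond_single W0 w0 T t S s w); split=> //; [apply: joined132|apply: triple132|case: est; [right|left]].
subst S T; exists W0, w0, s, t; split=> //.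
case: est => h; split=> //; first exact: apex_other J wW0 ew eq h.
exact: apex_other (joined132 J) wW0 ew (triple132 eq) h.
Qed.

(** By [hub_apex] each of [w], [s], [t] may serve as the base point, which gives
    the edges [qwt] and [qws]. With [qwt] present, [w0] must be [w], and then
    the diamond based at [s] shows that the branch at [w] is trivial. *)
Lemma hub_five w x : w \in W -> x \in W -> x <> w -> triple r q w -> triple r q x ->
  exists s t, [/\ W = [set w; s; t], triple w s t, triple q s t, triple q w s /\ triple q w t & triple r q s /\ triple r q t].
Proof.
move=> wW xW nxw ew ex; have [W0 [w0 [s [t [J wW0 eq [es et] Z]]]]] := hub_apex wW xW nxw ew ex.
have [sW0 sS sT] := joined_subs J.
have sW := sS _ (set11 s); have tW' := sT _ (set11 t).
have W0s : s \notin W0 := apart1r (jAB J); have W0t : t \notin W0 := apart1r (jAC J).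
have [nws nwt nst] : [/\ w <> s, w <> t & s <> t] by split; [set_tac|set_tac|case: (triple_distinct eq)].
(* Based at a, the apex pair is formed by the two other vertices joined to rq. *)
have third a b : a \in W -> b \in W -> triple r q a -> triple r q b -> w <> a -> b <> a -> b <> w -> triple q w b.
  move=> aW bW ea eb n1 n2 n3.
  have [_ [_ [s' [t' [_ _ eq' _ Z']]]]] := hub_apex aW wW n1 ea ew.
  case: (Z' w wW ew n1) (Z' b bW eb n2) => ? [?|?]; subst => //; exact: triple132.
have eqwt : triple q w t by apply: (third s t) => //; congruence.
have eqws : triple q w s by apply: (third t s) => //; congruence.
have ew0 : w0 = w.
  apply: NNPP => n; have [X [sX pX]] := tree_set_path (jtA J) (jA J) wW0.
  have e1 : triple t w0 s := triple312 (jE J). have w0W0 := jA J.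
  by apply: (close_path nc (path_edge e1) pX _ n _ (triple321 eqwt)); case: (triple_distinct e1) => *; set_tac.
subst w0.
have eW0 : W0 = [set w].
  apply: (@diamond_single [set s] s W0 w [set t] t s); split=> //; [exact: joined213 J|exact: set11|by left].
by exists s, t; split=> //; [rewrite (jU J) eW0 | exact: jE J].
Qed.
End Hub.

(** The edge [rab] is the only candidate for the edge closing at the leaf [a] in
    the tree with edges [aqc] and [rqb]. *)
Lemma root_edge q a b c : U = [set r] :|: [set q] :|: ([set a] :|: [set b] :|: [set c]) ->
  triple r q b -> triple q a c -> r <> a -> r <> c -> a <> b -> b <> c -> triple r a b.
Proof.
move=> eU e1 e2 n1 n2 n3 n4.
have [m1 m2 m3] := triple_distinct e1; have [m4 m5 m6] := triple_distinct e2.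
have tB : tree_set ([set r] :|: [set q] :|: [set b]).
  by apply: (@tree_set3 _ _ _ _ _ r q b) => //; try exact: tree_set1; set_tac.
have J : joined U [set a] a ([set r] :|: [set q] :|: [set b]) q [set c] c.
  have eU' : U = [set a] :|: ([set r] :|: [set q] :|: [set b]) :|: [set c] by rewrite eU; set_eq_tac.
  by split=> //; try exact: tree_set1; set_tac; apply: triple213.
have [|u [v [uU vU [nuq nuc] [nvq nvc] e]]] := gU J; first by congruence.
have [k1 k2 k3] := triple_distinct e.
have inR x : x \in U -> x <> a -> x <> q -> x <> c -> x = r \/ x = b.
  by rewrite eU => h *; repeat forward; auto.
have [|||eu|eu] := inR u uU; try congruence.
  have [|||ev|ev] := inR v vU; try congruence.
  by subst; apply: triple213.
have [|||ev|ev] := inR v vU; try congruence.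
by subst; apply: triple312 e.
Qed.

Lemma complete_five : U <> [set r] ->
  exists q a b c, [/\ triple r q a /\ triple r q b, triple r q c /\ triple r a b, triple r a c /\ triple r b c, triple q a b /\ triple q a c & triple q b c /\ triple a b c].
Proof.
move=> nU; have [Q [q [W [w [x [J xW nxw ex]]]]]] := pseudo_cycle_exists nU.
have eQ : Q = [set q] by apply: (@hub_single Q q W w x); split.
subst Q; have rW : r \notin W := apart1l (jAC J); have qW : q \notin W := apart1l (jBC J).
have nrq : r <> q by case: (triple_distinct ex).
have [s [t [eW ewst eqst [eqws eqwt] [es et]]]] := hub_five (jtC J) rW qW nrq (jU J) (jC J) xW nxw (jE J) ex.
exists q, w, s, t; have ew := jE J.
have eU := jU J; rewrite eW in eU.
have [? ? ?] := triple_distinct ewst; have [? ? ?] := triple_distinct ew.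
have [? ? ?] := triple_distinct es; have [? ? ?] := triple_distinct et.
do !split=> //.
- by apply: (@root_edge q w s t).
- by apply: (@root_edge q w t s) => //; [rewrite eU; set_eq_tac | congruence].
- by apply: (@root_edge q s t w) => //; [rewrite eU; set_eq_tac | apply: triple132 | congruence].
Qed.
End MinimalCounterexample.

(** * Two-colourability *)

Section Colouring.
Variable (V : finType).
Implicit Types (H : hypergraph3 V) (A B C U R S e f : {set V}) (a b c d x y z r : V).

Lemma complete_five_contained H q r a b c :
  [/\ triple H r q a /\ triple H r q b, triple H r q c /\ triple H r a b, triple H r a c /\ triple H r b c,
      triple H q a b /\ triple H q a c & triple H q b c /\ triple H a b c] ->
  contains_subhypergraph (complete3 5) H.
Proof.
move=> [[e1 e2] [e3 e4] [e5 e6] [e7 e8] [e9 e10]].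
have [? ? ?] := triple_distinct e1; have [? ? ?] := triple_distinct e10.
have [? ? ?] := triple_distinct e6; have [? ? ?] := triple_distinct e9.
exists (fun i : 'I_5 => nth r [:: r; q; a; b; c] i).
have inj : injective (fun i : 'I_5 => nth r [:: r; q; a; b; c] i).
  move=> i j /eqP; rewrite nth_uniq //= => [/eqP /val_inj //|].
  by rewrite !inE; do !(case: eqVneq => [?|_]; first congruence).
split=> // e; rewrite inE => /eqP /set3_of_card [i [j [k [-> nij nik njk]]]].
rewrite !imsetU !imset_set1.
have ne (i' j' : 'I_5) : i' <> j' -> (i' : nat) <> j' by move=> n /val_inj.
move: (ne _ _ nij) (ne _ _ nik) (ne _ _ njk).
case: i {nij nik} => [[|[|[|[|[|//]]]]] ?]; case: j {njk} => [[|[|[|[|[|//]]]]] ?] //=;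
case: k => [[|[|[|[|[|//]]]]] ?] //= _ _ _; 
first [assumption|exact: triple132|exact: triple213|exact: triple231|exact: triple312|exact: triple321].
Qed.

(** Induction on the size of [U]: if no five vertices exist, the only smaller
    leaf-closing sets are single vertices, which is the hypothesis under which
    [complete_five] was derived. *)
Lemma leaf_closing_complete_five H U r : ~ has_linear_cycle H -> tree_set H U -> r \in U -> leaf_closing H U r -> U <> [set r] ->
  contains_subhypergraph (complete3 5) H.
Proof.
move=> nc; have [n] := ubnP #|U|; elim: n U r => // n IH U r /ltnSE ltn tU rU gU nU.
apply: NNPP => nK.
have IH' A a : #|A| < #|U| -> tree_set H A -> a \in A -> leaf_closing H A a -> A = [set a].
  by move=> lt tA aA gA; apply: NNPP => nA; apply: nK; apply: (IH A a) => //; apply: leq_trans ltn.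
have [q [a [b [c K]]]] := complete_five nc tU rU gU IH' nU.
exact: nK (complete_five_contained K).
Qed.

(** A largest tree set is leaf-closing: a private edge at a leaf that left the set
    at both other vertices would extend the tree, and one that left it at one
    vertex would close a linear cycle. *)
Lemma private_edges_complete_five H : ~ has_linear_cycle H -> edges H <> set0 ->
  (forall e x, e \in edges H -> x \in e -> exists2 f, f \in edges H & e :&: f = [set x]) ->
  contains_subhypergraph (complete3 5) H.
Proof.
move=> nc /eqP /set0Pn [e0 e0H] priv.
have [a0 [b0 [c0 [eabc nab nac nbc]]]] := set3_of_card (edges_card3 e0H).
have e0E : triple H a0 b0 c0 by rewrite /triple -eabc.
have J0 : joined H [set a0; b0; c0] [set a0] a0 [set b0] b0 [set c0] c0.
  by split; try exact: tree_set1; try exact: set11; set_tac.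
have [|U [tU mU]] := @ex_max_card V (tree_set H); first by exists [set a0]; apply: tree_set1.
have [r rU] : exists r, r \in U.
  by case: tU => [v|A B C a b c _ _ _ _ _ _ aA _ _ _]; [exists v|exists a]; rewrite !inE ?aA ?eqxx.
apply: (@leaf_closing_complete_five H U r) => //; last first.
  move=> eU; have := mU _ (joined_tree_set J0).
  by rewrite (joined_card J0) eU !cards1.
move=> y B b C c J _.
have yE : y \in [set y; b; c] by mem_tac.
have [f fH ef] := priv _ y (jE J) yE.
have yf : y \in f by have := set11 y; rewrite -ef inE => /andP [].
have nf z : z \in f -> z <> y -> z <> b /\ z <> c.
  by move=> zf zy; split=> ?; subst; apply: zy; apply/set1P; rewrite -ef !inE zf ?eqxx ?orbT.
have [u [v e]] : exists u v, triple H y u v /\ f = [set y; u; v].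
  have : #|f :\ y| == 2 by have := cardsD1 y f; rewrite yf (edges_card3 fH); lia.
  by move=> /cards2P [u [v [_ ef']]]; exists u, v; rewrite /triple -setUA -ef' setD1K.
have [e1 eqf] := e; have [nyu nyv nuv] := triple_distinct e1.
have [nub nuc] : u <> b /\ u <> c by apply: nf; [rewrite eqf; mem_tac | congruence].
have [nvb nvc] : v <> b /\ v <> c by apply: nf; [rewrite eqf; mem_tac | congruence].
have yU : y \in U by rewrite (jU J); mem_tac.
have attach u1 v1 : u1 \in U -> v1 \notin U -> u1 <> b -> u1 <> c -> ~ triple H y u1 v1.
  move=> u1U v1U n1 n2 e2.
  have bypath D d D' d' : joined H U [set y] y D d D' d' -> u1 \in D -> u1 <> d -> False.
    move=> J1 h1 h2; have [X [sX pX]] := tree_set_path (jtB J1) (jB J1) h1.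
    have [_ sD sD'] := joined_subs J1; have dD := jB J1; have d'D' := jC J1.
    have [n3 _ _] := triple_distinct (jE J1); have dd := jBC J1; have yD := apart1l (jAB J1).
    apply: (close_path nc (path_edge (jE J1)) pX _ _ _ e2); set_tac.
  move: (u1U); rewrite {1}(jU J) => /setUP [/setUP [/set1P ?|h]|h].
  - by subst; case: (triple_distinct e2).
  - exact: bypath J h n1.
  - exact: bypath (joined132 J) h n2.
case: (boolP (u \in U)) (boolP (v \in U)) => [uU|uU] [vU|vU].
- by exists u, v.
- by case: (attach u v).
- by case: (attach v u) => //; apply: triple132.
- have J1 : joined H (U :|: [set u] :|: [set v]) U y [set u] u [set v] v.
    by split=> //; try exact: tree_set1; try exact: set11; set_tac.
  by have := mU _ (joined_tree_set J1); rewrite (joined_card J1) !cards1 -addnA -[leqRHS]addn0 leq_add2l.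
Qed.

(** Moving [x] to the other class breaks the monochromatic edge [e]; an edge that
    becomes monochromatic contains [x] and has its other vertices outside [R],
    hence meets [e] only in [x]. *)
Lemma flip_two_colouring H H' x e R : edges H' = edges H :\ e -> e \in edges H -> x \in e ->
  (forall f, f \in edges H -> e :&: f <> [set x]) ->
  independent H' R -> independent H' (~: R) -> e \subset R ->
  independent H (R :\ x) /\ independent H (~: (R :\ x)).
Proof.
move=> eH' eH xe priv /forall_inP iR /forall_inP iR' sub; split; apply/forall_inP=> f fH; apply/negP=> sf.
  have nfe : f != e by apply/eqP=> ?; subst; move/subsetP: sf => /(_ x xe); rewrite !inE eqxx.
  have /iR : f \in edges H' by rewrite eH' !inE nfe.
  by rewrite (subset_trans sf) // subsetDl.
have nfe : f != e.
  apply/eqP=> ?; subst f; have := edges_card3 eH.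
  suff -> : e = [set x] by rewrite cards1.
  apply/eqP; rewrite eqEsubset sub1set xe andbT; apply/subsetP=> z ze.
  have := subsetP sf z ze; rewrite !inE (subsetP sub z ze); case: (z == x) => //.
have fH' : f \in edges H' by rewrite eH' !inE nfe.
case: (boolP (x \in f)) => xf; last first.
  case/negP: (iR' f fH'); apply/subsetP=> z zf; have := subsetP sf z zf; rewrite !inE.
  by case: eqVneq zf xf => // -> ->.
apply: (priv f fH); apply/setP=> z; rewrite !inE; apply/andP/eqP => [[ze zf]|->] //.
have := subsetP sf z zf; rewrite !inE (subsetP sub z ze).
by case: eqVneq.
Qed.

Lemma linear_cycle_subgraph H H' : {subset edges H' <= edges H} -> has_linear_cycle H' -> has_linear_cycle H.
Proof.
move=> s [k [v [h [k3 [inj hE adj ends far]]]]]; exists k, v, h; split=> //; split=> // i; exact: s.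
Qed.

Lemma contains_subgraph (W : finType) (F : hypergraph3 W) H H' : {subset edges H' <= edges H} ->
  contains_subhypergraph F H' -> contains_subhypergraph F H.
Proof. by move=> s [f [inj fE]]; exists f; split=> // e /fE /s. Qed.

Lemma two_colourable H : ~ has_linear_cycle H -> ~ contains_subhypergraph (complete3 5) H ->
  exists R, independent H R /\ independent H (~: R).
Proof.
have [n] := ubnP #|edges H|; elim: n H => // n IH H /ltnSE ltn nc nK.
have [e0|n0] := classic (edges H = set0).
  by exists set0; split; apply/forall_inP=> e; rewrite e0 inE.
have [e [x [eH xe priv]]] : exists e x, [/\ e \in edges H, x \in e & forall f, f \in edges H -> e :&: f <> [set x]].
  apply: NNPP => no; apply: nK; apply: private_edges_complete_five => // e x eH xe.
  apply: NNPP => no2; apply: no; exists e, x; split=> // f fH ef; apply: no2; by exists f.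
have H'c f : f \in edges H :\ e -> #|f| = 3 by rewrite inE => /andP [_ /edges_card3].
pose H' := Hypergraph3 H'c.
have sH' : {subset edges H' <= edges H} by move=> f /=; rewrite inE => /andP [].
have [|||R [iR iR']] := IH H'.
- by move: ltn; rewrite (cardsD1 e (edges H)) eH.
- by move=> c; apply: nc; apply: linear_cycle_subgraph c.
- by move=> c; apply: nK; apply: contains_subgraph c.
case: (boolP (e \subset R)) => sR.
  by have := @flip_two_colouring H H' x e R erefl eH xe priv iR iR' sR; exists (R :\ x).
case: (boolP (e \subset ~: R)) => sR'.
  have := @flip_two_colouring H H' x e (~: R) erefl eH xe priv iR'; rewrite setCK => /(_ iR sR').
  by exists (~: R :\ x).
exists R; split; apply/forall_inP=> f fH; have [->//|nfe] := eqVneq f e.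
  by apply: (forall_inP iR); rewrite /= !inE nfe.
by apply: (forall_inP iR'); rewrite /= !inE nfe.
Qed.

Lemma alpha_lower_bound H : ~ has_linear_cycle H -> ~ contains_subhypergraph (complete3 5) H ->
  uphalf #|V| <= alpha H.
Proof.
move=> nc nK; have [R [iR iR']] := two_colourable nc nK.
have le1 : #|R| <= alpha H by apply: (@leq_bigmax_cond _ (independent H) (fun I : {set V} => #|I|)).
have le2 : #|~: R| <= alpha H by apply: (@leq_bigmax_cond _ (independent H) (fun I : {set V} => #|I|)).
have := cardsC R; move: le1 le2; move: #|R| #|~: R| (alpha H) #|V| => *; lia.
Qed.
End Colouring.

(** * Sharpness *)

(** For increasing [a], [b], [c], the condition [b./2 == c./2] says that [b] and
    [c] form one of the pairs 2j, 2j+1. *)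
Definition tower_triple (a b c : nat) := [&& a < b, b < c & (c <= 3) || (b./2 == c./2)].

(** Memberships would enter the arithmetic solver as boolean unknowns, so they are
    discarded first. *)
Ltac nat_lia := repeat match goal with
  | H : is_true (_ \in _) |- _ => clear H | H : is_true (tower_triple _ _ _) |- _ => clear H end; lia.

Lemma cycle_neighbours (V : finType) (H : hypergraph3 V) k (v : 'I_k -> V) h : 3 <= k -> is_linear_cycle H v h ->
  forall i, exists j1 j2 z1 z2, [/\ z1 <> z2, h i :&: h j1 = [set z1] & h i :&: h j2 = [set z2]].
Proof.
move=> k3 [[vi hi] hE adj ends _] i.
have k0 : 0 < k by lia.
have ltk m : (if m < k then m else 0) < k by case: ifP.
pose O m := Ordinal (ltk m).
have OE m : m < k -> O m = m :> nat by move=> lm /=; rewrite lm.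
have ne (i1 i2 : 'I_k) : i1 <> i2 :> nat -> v i1 <> v i2 by move=> n1 /vi n2; apply: n1; rewrite n2.
have := ltn_ord i => ik.
have [i0|i0] := posnP i.
  exists (O 1), (O k.-1), (v (O 1)), (v i); split.
  - by apply: ne; rewrite OE; lia.
  - by apply: adj; rewrite OE; lia.
  - by apply: ends; rewrite ?OE; lia.
have e1 : h i :&: h (O i.-1) = [set v i] by rewrite setIC; apply: adj; rewrite OE; lia.
have [il|il] := eqVneq (i : nat) k.-1.
  exists (O 0), (O i.-1), (v (O 0)), (v i); split=> //.
  - by apply: ne; rewrite OE; lia.
  - by rewrite setIC; apply: ends; rewrite ?OE; lia.
exists (O i.+1), (O i.-1), (v (O i.+1)), (v i); split=> //.
- by apply: ne; rewrite OE; lia.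
- by apply: adj; rewrite OE; lia.
Qed.

Section Tower.
Variable n : nat.
Implicit Types (e g I : {set 'I_n}) (a b c x y z : 'I_n).

Definition tower_edges : {set {set 'I_n}} :=
  [set [set t.1.1; t.1.2; t.2] | t : 'I_n * 'I_n * 'I_n & tower_triple t.1.1 t.1.2 t.2].

Lemma tower_edgesP e : reflect (exists a b c, e = [set a; b; c] /\ tower_triple a b c) (e \in tower_edges).
Proof.
apply: (iffP imsetP) => [[[[a b] c]]|[a [b [c [-> h]]]]]; first by rewrite inE /= => h ->; exists a, b, c.
by exists (a, b, c); rewrite ?inE.
Qed.

Lemma tower_card3 e : e \in tower_edges -> #|e| = 3.
Proof.
move=> /tower_edgesP [a [b [c [-> /and3P [ab bc _]]]]].
rewrite setUC cardsU1 cards2 !inE negb_or; do !(rewrite -val_eqE /=); lia.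
Qed.

Definition tower : hypergraph3 'I_n := Hypergraph3 tower_card3.

Lemma tower_small_card : #|[set x : 'I_n | x < 4]| <= 4.
Proof.
rewrite cardE -(size_map val) -[4](size_iota 0) uniq_leq_size ?map_inj_uniq ?enum_uniq //; first exact: val_inj.
by move=> m /mapP [x]; rewrite mem_enum inE mem_iota => x4 ->.
Qed.

(** Of two edges meeting in one vertex, let [e] have the larger top [c]. If [c >
    3], then [c] and its partner [b] form a pair, and an edge with top at most
    [c] that contains [b] or [c] either contains both or has top [b], which is
    impossible because [b] is the smaller number of its pair. Below 4, two
    edges share two vertices. *)
Lemma tower_meet_min e g z : e \in tower_edges -> g \in tower_edges -> e :&: g = [set z] ->
  (forall x, x \in g -> exists2 y, y \in e & x <= y) -> forall y, y \in e -> z <= y.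
Proof.
move=> eE gE eq top.
have [a [b [c [ee t1]]]] := tower_edgesP _ eE; have [a' [b' [c' [eg t2]]]] := tower_edgesP _ gE.
have in_e y : y \in e -> [\/ y = a, y = b | y = c].
  by rewrite ee => /setUP [/setUP [/set1P ->|/set1P ->]|/set1P ->]; [constructor 1|constructor 2|constructor 3].
have in_g y : y \in g -> [\/ y = a', y = b' | y = c'].
  by rewrite eg => /setUP [/setUP [/set1P ->|/set1P ->]|/set1P ->]; [constructor 1|constructor 2|constructor 3].
have [ae be ce] : [/\ a \in e, b \in e & c \in e] by rewrite ee; split; mem_tac.
have [a'g b'g c'g] : [/\ a' \in g, b' \in g & c' \in g] by rewrite eg; split; mem_tac.
have common x y : x \in e -> y \in g -> x = y :> nat -> x = z.
  by move=> xe yg /val_inj ?; subst y; apply/set1P; rewrite -eq inE xe.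
have /setIP [ze zg] : z \in e :&: g by rewrite eq set11.
case/and3P: (t1) => ab bc /orP tc; case/and3P: (t2) => ab' bc' /orP tc'.
have lec : c' <= c by have [y /in_e [->|->|->]] := top c' c'g; nat_lia.
have [c3|c4] := leqP c 3.
  have sub : e :|: g \subset [set x : 'I_n | x < 4].
    by apply/subsetP=> x /setUP [/in_e|/in_g] [->|->|->]; rewrite inE; nat_lia.
  have := leq_trans (subset_leq_card sub) tower_small_card.
  have := cardsUI e g; rewrite eq cards1 (tower_card3 eE) (tower_card3 gE); nat_lia.
have bc2 : c = b.+1 :> nat /\ ~~ odd b by nat_lia.
suff -> : z = a by move=> y /in_e [->|->|->]; nat_lia.
have zc : z <> c.
  move=> zc; have ecc : c' = c :> nat.
    by have := in_g z zg; rewrite zc => -[] /(congr1 val) /= e1; nat_lia.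
  have ebb : b' = b :> nat by nat_lia.
  have := common b b' be b'g (esym ebb); rewrite zc => /(congr1 val) /= e1; nat_lia.
case: (in_e z ze) => // zb; exfalso.
have zcn : z <> c :> nat by move=> /val_inj.
have ncc : c' <> c :> nat by move=> /esym /(common c c' ce c'g) /esym.
have := in_g z zg; rewrite zb => -[] /(congr1 val) /= e1; nat_lia.
Qed.

Lemma tower_no_cycle : ~ has_linear_cycle tower.
Proof.
move=> [k [v [h [k3 cyc]]]]; have [_ hE _ _ _] := cyc.
have k0 : 0 < k by lia.
pose top (i : 'I_k) := \max_(x in h i) (x : nat).
have [i _ imax] := @arg_maxnP _ (Ordinal k0) xpredT top isT.
have dom j x : x \in h j -> exists2 y, y \in h i & x <= y.
  move=> xj; have hi0 : 0 < #|h i| by rewrite (edges_card3 (hE i)).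
  have [y yi ey] := eq_bigmax_cond (fun x : 'I_n => x : nat) hi0.
  exists y => //; rewrite -ey; apply: leq_trans (imax j isT).
  exact: (@leq_bigmax_cond _ (mem (h j)) (fun x : 'I_n => x : nat)).
have [j1 [j2 [z1 [z2 [nz e1 e2]]]]] := cycle_neighbours k3 cyc i.
have m1 := tower_meet_min (hE i) (hE j1) e1 (dom j1).
have m2 := tower_meet_min (hE i) (hE j2) e2 (dom j2).
have z1i : z1 \in h i by have := set11 z1; rewrite -e1 inE => /andP [].
have z2i : z2 \in h i by have := set11 z2; rewrite -e2 inE => /andP [].
by apply: nz; apply/val_inj/eqP; rewrite eqn_leq m1 // m2.
Qed.

Lemma tower_edge_top a b c : [set a; b; c] \in tower_edges -> a < c -> b < c -> 3 < c ->
  a./2 = c./2 \/ b./2 = c./2.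
Proof.
move=> /tower_edgesP [a' [b' [c' [es /and3P [l1 l2 l3]]]]] ac bc c4.
have in_e x : x \in [set a'; b'; c'] -> [\/ x = a, x = b | x = c].
  by rewrite -es => /setUP [/setUP [/set1P ->|/set1P ->]|/set1P ->]; [constructor 1|constructor 2|constructor 3].
have in_e' x : x \in [set a; b; c] -> [\/ x = a', x = b' | x = c'].
  by rewrite es => /setUP [/setUP [/set1P ->|/set1P ->]|/set1P ->]; [constructor 1|constructor 2|constructor 3].
have cc : c = c' :> nat.
  have [] := in_e' c ltac:(mem_tac) => /(congr1 val) /= e1; have [] := in_e c' ltac:(mem_tac) => /(congr1 val) /= e2; lia.
have [] := in_e b' ltac:(mem_tac) => /(congr1 val) /= e1; [left|right|]; lia.
Qed.

(** Among five vertices the largest is at least 4, so any two of the other four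
    include its partner; two disjoint such choices contradict each other. *)
Lemma tower_no_complete_five : ~ contains_subhypergraph (complete3 5) tower.
Proof.
move=> [f [inj fE]].
have [i _ imax] := @arg_maxnP _ (ord0 : 'I_5) xpredT (fun i => f i : nat) isT.
have lti j : j <> i -> f j < f i.
  move=> nji; rewrite ltn_neqAle; have := imax j isT => /= ->; rewrite andbT.
  by apply/eqP=> /val_inj /inj.
(* f i is the top of these edges. *)
have edge_i j1 j2 : j1 <> i -> j2 <> i -> j1 <> j2 -> 3 < f i -> (f j1)./2 = (f i)./2 \/ (f j2)./2 = (f i)./2.
  move=> n1 n2 n3 i3; apply: tower_edge_top; [| exact: lti | exact: lti | exact: i3].
  have := fE [set j1; j2; i]; rewrite !imsetU !imset_set1; apply.
  rewrite inE setUC cardsU1 cards2 !inE negb_or.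
  by rewrite (introF eqP (nesym n1)) (introF eqP (nesym n2)) (introF eqP n3).
have [j1 [j2 [j3 [j4 u]]]] : exists j1 j2 j3 j4, uniq [:: i; j1; j2; j3; j4].
  have := enum_uniq [set~ i]; have : size (enum [set~ i]) = 4 by rewrite -cardE cardsC1 card_ord.
  have : i \notin enum [set~ i] by rewrite mem_enum !inE eqxx.
  case: (enum _) => [|j1 [|j2 [|j3 [|j4 [|]]]]] //= ni _ u.
  by exists j1, j2, j3, j4; rewrite /= ni.
move: u; rewrite /= !inE !negb_or.
move=> /and5P [/and4P [/eqP n1 /eqP n2 /eqP n3 /eqP n4] /and3P [/eqP n5 /eqP n6 /eqP n7] /andP [/eqP n8 /eqP n9] /eqP n10 _].
have l1 := lti j1 (nesym n1); have l2 := lti j2 (nesym n2); have l3 := lti j3 (nesym n3); have l4 := lti j4 (nesym n4).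
have nf (j j' : 'I_5) : j <> j' -> f j <> f j' :> nat by move=> d /val_inj /inj.
have m1 := nf _ _ n5; have m2 := nf _ _ n6; have m3 := nf _ _ n7; have m4 := nf _ _ n8; have m5 := nf _ _ n9; have m6 := nf _ _ n10.
have i3 : 3 < f i by clear -l1 l2 l3 l4 m1 m2 m3 m4 m5 m6; lia.
have := edge_i j1 j2 (nesym n1) (nesym n2) n5 i3.
have := edge_i j3 j4 (nesym n3) (nesym n4) n10 i3.
clear -l1 l2 l3 l4 m1 m2 m3 m4 m5 m6; lia.
Qed.

(** Sending each vertex to the index of its pair is injective on [I] except for a
    complete pair. There is at most one, all other members of [I] lie above
    it, and the slot 0, or the slot 1 for the pair 0, 1, is free for its
    second vertex. *)
Lemma tower_independent I : 2 < n -> independent tower I -> #|I| <= uphalf n.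
Proof.
move=> n3 /forall_inP iI.
have no_triple a b c : a \in I -> b \in I -> c \in I -> tower_triple a b c -> False.
  move=> aI bI cI t; have := iI [set a; b; c]; rewrite /= => /(_ _)/negP; apply.
    by apply/tower_edgesP; exists a, b, c.
  by rewrite !subUset !sub1set aI bI cI.
have small a b c : a \in I -> b \in I -> c \in I -> a < b < c -> 3 < c.
  move=> aI bI cI lt; rewrite ltnNge; apply/negP=> c3; apply: (no_triple a b c) => //.
  by rewrite /tower_triple c3 andbT.
have above a b c : a \in I -> b \in I -> c \in I -> b <> c -> b./2 = c./2 -> b./2 <= a./2.
  move=> aI bI cI nbc hbc; rewrite leqNgt; apply/negP=> lt.
  have nbc' : b <> c :> nat by move=> /val_inj.
  have [bc|cb] := ltnP b c.
    by apply: (no_triple a b c) => //; rewrite /tower_triple hbc eqxx; clear -lt bc; lia.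
  by apply: (no_triple a c b) => //; rewrite /tower_triple hbc eqxx; clear -lt cb nbc' hbc; lia.
pose paired x := [exists y in I, (y != x) && (y./2 == x./2)].
pose slot x := if paired x then (if x < 2 then (x : nat) else if odd x then x./2 else 0) else x./2.
have slot_lt x : slot x < uphalf n.
  have := ltn_ord x; rewrite /slot; do ?case: ifP; clear -n3; lia.
have pairedI x y : y \in I -> y <> x -> y./2 = x./2 -> paired x.
  by move=> yI nyx hyx; apply/existsP; exists y; rewrite yI hyx eqxx andbT; apply/eqP.
have mixed x y : x \in I -> y \in I -> paired x -> ~~ paired y -> slot x = slot y -> x = y.
  move=> xI yI px py; rewrite /slot px (negPf py) => es; apply: NNPP => nxy.
  move: (px) => /existsP [x' /and3P [x'I /eqP nx /eqP hx]].
  have le := above y x x' yI xI x'I (nesym nx) (esym hx).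
  have ne : x./2 <> y./2 by move=> e; move/negP: py; apply; apply: (pairedI y x).
  have nx' : x' <> x :> nat by move=> /val_inj.
  have sm := small x' x y x'I xI yI.
  move: es; do ?case: ifP; clear -le ne nx' hx sm; lia.
have both x y : x \in I -> y \in I -> paired x -> paired y -> x./2 < y./2 -> False.
  move=> xI yI _ /existsP [y' /and3P [y'I /eqP ny /eqP hy]].
  by have := above x y y' xI yI y'I (nesym ny) (esym hy); rewrite leqNgt => /negP.
have slot_inj : {in I &, injective slot}.
  move=> x y xI yI.
  case: (boolP (paired x)) (boolP (paired y)) => [px|px] [py|py].
  - rewrite /slot px py => es; apply/val_inj => /=.
    case: (ltngtP x./2 y./2) => [/(both x y xI yI px py)|/(both y x yI xI py px)|h] //.
    move: es; do ?case: ifP; clear -h; lia.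
  - exact: mixed.
  - by move/esym => /(mixed y x yI xI py px) ->.
  - move=> es; apply: NNPP => nxy; case: (negP px); apply: (pairedI x y) => //; first by move/esym.
    by move: es; rewrite /slot (negPf px) (negPf py) => ->.
rewrite -(card_in_imset (f := fun x => Ordinal (slot_lt x))); last first.
  by move=> x y xI yI [] /(slot_inj x y xI yI).
by apply: leq_trans (max_card _) _; rewrite card_ord.
Qed.
End Tower.

Lemma tower_sharp n : 2 < n -> alpha (tower n) = uphalf n.
Proof.
move=> n3; apply/eqP; rewrite eqn_leq; apply/andP; split.
  by apply/bigmax_leqP => I iI; apply: tower_independent.
by rewrite -{1}(card_ord n); apply: alpha_lower_bound; [apply: tower_no_cycle | apply: tower_no_complete_five].
Qed.

Theorem corollary3 :
  (forall (n : nat) (V : finType) (H : hypergraph3 V),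
     #|V| = n ->
     ~ has_linear_cycle H ->
     ~ contains_subhypergraph (complete3 5) H ->
     uphalf n <= alpha H)
  /\
  (forall n : nat, 3 <= n ->
     exists H : hypergraph3 'I_n,
       [/\ ~ has_linear_cycle H,
           ~ contains_subhypergraph (complete3 5) H
         & alpha H = uphalf n]).
Proof.
split=> [n V H <-|n n3]; first exact: alpha_lower_bound.
by exists (tower n); split; [apply: tower_no_cycle | apply: tower_no_complete_five | apply: tower_sharp].
Qed.
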